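(* Let $n\in\mathbb{N}$ and let $\Gamma$ be a sequent. If $\Gamma$ is provable in $\mathsf{S}_n$ (i.e. there is a regular $\Pi_{n+1}$-restricted $\infty$-proof whose root is marked by $\Gamma$), then $\mathit{I\Sigma}_{n+1}\vdash\bigvee\Gamma$.
   Context: **Formulas and sequents.** Arithmetical terms are built from individual variables $\mathit{Var}=\{x_0,x_1,\dots\}$ and the constant $0$ by the unary symbol $s$ and the binary symbols $+,\cdot$. Arithmetical formulas are given by $\varphi::=t=t\mid t\neq t\mid(\varphi\wedge\varphi)\mid(\varphi\vee\varphi)\mid\forall y\,\varphi\mid\exists y\,\varphi$. Negation $\overline{\varphi}$ is the syntactic operation swapping $=$ with $\neq$, $\wedge$ with $\vee$, $\forall$ with $\exists$ (so $\overline{\overline\varphi}=\varphi$). Put $\bot:=0\neq 0$, $\varphi\to\psi:=\overline\varphi\vee\psi$. $x\leq y$ abbreviates $\exists z\,(z+x=y)$. $\varphi[y\mapsto t]$ is the substitution of $t$ for all free occurrences of $y$ (no variable of $t$ may become bound). A sequent is a finite multiset of formulas, interpreted as $\bigvee\Gamma$ (with $\bigvee\emptyset:=\bot$); the comma denotes multiset union. $\mathit{FV}$ denotes the set of free variables. **Classes.** Bounded quantifiers: $\forall y\leq t\,\varphi:=\forall y(y\leq t\to\varphi)$, $\exists y\leq t\,\varphi:=\exists y(y\leq t\wedge\varphi)$, with $y$ not in $t$. $\Delta_0=\Sigma_0=\Pi_0$ is the set of formulas built from atomic formulas by logical connectives and bounded quantifiers only. A formula is $\Sigma_{n+1}$ (resp.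 $\Pi_{n+1}$) if it is obtained from $\Pi_n$ (resp. $\Sigma_n$) formulas using existential (resp. universal) quantifiers and $\wedge,\vee$. **Theories.** Robinson's arithmetic $\mathsf{Q}$: first-order logic with equality plus (universal closures of) $\neg s(x)=0$; $s(x)=s(y)\to x=y$; $x=0\vee\exists y\,x=s(y)$; $x+0=x$; $x+s(y)=s(x+y)$; $x\cdot0=0$; $x\cdot s(y)=x\cdot y+x$. $\mathit{I\Sigma}_n$ is $\mathsf{Q}$ plus the induction schema $\varphi(0)\wedge\forall x(\varphi(x)\to\varphi(s(x)))\to\forall x\,\varphi(x)$ for all $\Sigma_n$ formulas $\varphi$ (possibly with other free variables). **Calculus $\mathsf{SQ}$.** Initial sequents: $\Gamma,t_0=t_1,t_0\neq t_1$ and $\Gamma,s(t)\neq0$. Rules (premisses / conclusion): $(\wedge)$: $\Gamma,\varphi$ and $\Gamma,\psi$ / $\Gamma,\varphi\wedge\psi$; $(\vee)$: $\Gamma,\varphi,\psi$ / $\Gamma,\varphi\vee\psi$; $(\forall)$: $\Gamma,\varphi[y\mapsto z]$ / $\Gamma,\forall y\,\varphi$, where $z\notin\mathit{FV}(\Gamma,\forall y\,\varphi)$ ($z$ is the active variable); $(\exists)$: $\Gamma,\varphi[y\mapsto t],\exists y\,\varphi$ / $\Gamma,\exists y\,\varphi$; $(\mathsf{ref})$: $\Gamma,t\neq t$ / $\Gamma$; $(\mathsf{rep})$: $\Gamma,t_0\neq t_1,(u_0\neq u_1)[y\mapsto t_0],(u_0\neq u_1)[y\mapsto t_1]$ / $\Gamma,t_0\neq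 t_1,(u_0\neq u_1)[y\mapsto t_0]$; $(\mathsf{add}_0)$: $\Gamma,t+0\neq t$ / $\Gamma$; $(\mathsf{add}_s)$: $\Gamma,t+s(u)\neq s(t+u)$ / $\Gamma$; $(\mathsf{mult}_0)$: $\Gamma,t\cdot0\neq0$ / $\Gamma$; $(\mathsf{mult}_s)$: $\Gamma,t\cdot s(u)\neq t\cdot u+t$ / $\Gamma$; $(\mathsf{pred})$: $\Gamma,s(t_0)\neq s(t_1),t_0\neq t_1$ / $\Gamma,s(t_0)\neq s(t_1)$; $(\mathsf{case})$: left premiss $\Gamma[y\mapsto0]$ and right premiss $\Gamma[y\mapsto s(y)]$ / $\Gamma$, where $y\in\mathit{FV}(\Gamma)$ ($y$ is the active variable); $(\mathsf{weak})$: $\Gamma$ / $\Gamma,\Delta$; $(\mathsf{cut})$: left premiss $\Gamma,\varphi$ and right premiss $\Gamma,\overline\varphi$ / $\Gamma$. **$\infty$-proofs.** An $\infty$-proof is a possibly infinite tree whose nodes are marked by sequents, constructed according to the rules of $\mathsf{SQ}$, with every leaf marked by an initial sequent, such that every infinite branch has a tail satisfying: (a) the tail does not pass through left premisses of $(\mathsf{case})$; (b) if the tail passes through the right premiss $\Gamma[z\mapsto s(z)]$ of $(\mathsf{case})$, then after that application the tail does not intersect applications of $(\forall)$ with active variable $z$; (c) for some variable $y$, the tail passes through the right premiss of $(\mathsf{case})$ with active variable $y$ infinitely many times. An $\infty$-proof is $\Pi_m$-restricted if every infinite branch has a tail satisfying (a)–(c) and: (d) if the tail passes through the left (right) premiss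 of $(\wedge)$, then $\varphi$ ($\psi$) is in $\Pi_m$; (e) if the tail intersects an application of $(\forall)$, then $\varphi[y\mapsto z]\in\Pi_m$; (f) if the tail passes through the left (right) premiss of $(\mathsf{cut})$, then $\varphi$ ($\overline\varphi$) is in $\Pi_m$; (g) if the tail passes through the right premiss $\Gamma[z\mapsto s(z)]$ of $(\mathsf{case})$, then $z$ occurs freely only in $\Pi_m$-formulas of $\Gamma$. An $\infty$-proof is regular if it contains only finitely many non-isomorphic subtrees with respect to the marking of sequents. *)

(* Defs.v *)
From HB Require Import structures.
From mathcomp Require Import all_boot.
From mathcomp Require Import finmap multiset.

Set Implicit Arguments.
Unset Strict Implicit.
Unset Printing Implicit Defensive.

Local Open Scope mset_scope.

(* Variables are named: [Var i] is the individual variable x_i. *)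
Notation var := nat (only parsing).

Inductive term : Type :=
| Var of var
| Zero
| Succ of term
| Add of term & term
| Mul of term & term.

Inductive form : Type :=
| Eq of term & term
| Neq of term & term
| And of form & form
| Or of form & form
| All of var & form
| Ex of var & form.

(* [{mset form}] requires a choiceType; it is obtained by encoding the syntax
   in generic trees. *)
Fixpoint tree_of_term (t : term) : GenTree.tree nat :=
  match t with
  | Var x => GenTree.Leaf x
  | Zero => GenTree.Node 0 [::]
  | Succ u => GenTree.Node 1 [:: tree_of_term u]
  | Add u v => GenTree.Node 2 [:: tree_of_term u; tree_of_term v]
  | Mul u v => GenTree.Node 3 [:: tree_of_term u; tree_of_term v]
  end.

Fixpoint term_of_tree (T : GenTree.tree nat) : option term :=
  match T with
  | GenTree.Leaf x => Some (Var x)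
  | GenTree.Node 0 [::] => Some Zero
  | GenTree.Node 1 [:: U] => omap Succ (term_of_tree U)
  | GenTree.Node 2 [:: U; V] =>
      if term_of_tree U is Some u then omap (Add u) (term_of_tree V) else None
  | GenTree.Node 3 [:: U; V] =>
      if term_of_tree U is Some u then omap (Mul u) (term_of_tree V) else None
  | _ => None
  end.

Lemma tree_of_termK : pcancel tree_of_term term_of_tree.
Proof. by elim=> //= [t ->|t -> u ->|t -> u ->]. Qed.

HB.instance Definition _ := PCanIsCountable tree_of_termK.

Fixpoint tree_of_form (phi : form) : GenTree.tree (term * term + var) :=
  match phi with
  | Eq t u => GenTree.Node 0 [:: GenTree.Leaf (inl (t, u))]
  | Neq t u => GenTree.Node 1 [:: GenTree.Leaf (inl (t, u))]
  | And f g => GenTree.Node 2 [:: tree_of_form f; tree_of_form g]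
  | Or f g => GenTree.Node 3 [:: tree_of_form f; tree_of_form g]
  | All y f => GenTree.Node 4 [:: GenTree.Leaf (inr y); tree_of_form f]
  | Ex y f => GenTree.Node 5 [:: GenTree.Leaf (inr y); tree_of_form f]
  end.

Fixpoint form_of_tree (T : GenTree.tree (term * term + var)) : option form :=
  match T with
  | GenTree.Node 0 [:: GenTree.Leaf (inl (t, u))] => Some (Eq t u)
  | GenTree.Node 1 [:: GenTree.Leaf (inl (t, u))] => Some (Neq t u)
  | GenTree.Node 2 [:: U; V] =>
      if form_of_tree U is Some f then omap (And f) (form_of_tree V) else None
  | GenTree.Node 3 [:: U; V] =>
      if form_of_tree U is Some f then omap (Or f) (form_of_tree V) else None
  | GenTree.Node 4 [:: GenTree.Leaf (inr y); V] => omap (All y) (form_of_tree V)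
  | GenTree.Node 5 [:: GenTree.Leaf (inr y); V] => omap (Ex y) (form_of_tree V)
  | _ => None
  end.

Lemma tree_of_formK : pcancel tree_of_form form_of_tree.
Proof. by elim=> //= [f -> g ->|f -> g ->|y f ->|y f ->]. Qed.

HB.instance Definition _ := PCanIsCountable tree_of_formK.

Fixpoint neg (phi : form) : form :=
  match phi with
  | Eq t u => Neq t u
  | Neq t u => Eq t u
  | And f g => Or (neg f) (neg g)
  | Or f g => And (neg f) (neg g)
  | All y f => Ex y (neg f)
  | Ex y f => All y (neg f)
  end.

Definition bot : form := Neq Zero Zero.

Definition imp (phi psi : form) : form := Or (neg phi) psi.

Fixpoint tvars (t : term) : seq var :=
  match t with
  | Var x => [:: x]
  | Zero => [::]
  | Succ u => tvars u
  | Add u v | Mul u v => tvars u ++ tvars v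
  end.

Fixpoint FV (phi : form) : seq var :=
  match phi with
  | Eq t u | Neq t u => tvars t ++ tvars u
  | And f g | Or f g => FV f ++ FV g
  | All y f | Ex y f => [seq x <- FV f | x != y]
  end.

Fixpoint tsubst (y : var) (t : term) (u : term) : term :=
  match u with
  | Var x => if x == y then t else Var x
  | Zero => Zero
  | Succ v => Succ (tsubst y t v)
  | Add v w => Add (tsubst y t v) (tsubst y t w)
  | Mul v w => Mul (tsubst y t v) (tsubst y t w)
  end.

(* Replacement of the free occurrences of y by t, without renaming of bound
   variables; it is only used where [free_for y t phi] holds. *)
Fixpoint subst (y : var) (t : term) (phi : form) : form :=
  match phi with
  | Eq u v => Eq (tsubst y t u) (tsubst y t v)
  | Neq u v => Neq (tsubst y t u) (tsubst y t v)
  | And f g => And (subst y t f) (subst y t g)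
  | Or f g => Or (subst y t f) (subst y t g)
  | All x f => if x == y then All x f else All x (subst y t f)
  | Ex x f => if x == y then Ex x f else Ex x (subst y t f)
  end.

(* No variable of t becomes bound in [subst y t phi]. This always holds when
   the variables of t are all equal to y, in particular for [Zero] and
   [Succ (Var y)]. *)
Fixpoint free_for (y : var) (t : term) (phi : form) : bool :=
  match phi with
  | Eq _ _ | Neq _ _ => true
  | And f g | Or f g => free_for y t f && free_for y t g
  | All x f | Ex x f =>
      (y \notin FV (All x f)) || ((x \notin tvars t) && free_for y t f)
  end.

Notation sequent := {mset form}.

Definition in_FVs (x : var) (G : sequent) : Prop :=
  exists2 phi, phi \in G & x \in FV phi.

Definition ssubst (y : var) (t : term) (G : sequent) : sequent :=
  seq_mset [seq subst y t phi | phi <- G].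

Fixpoint bigor (s : seq form) : form :=
  match s with
  | [::] => bot
  | [:: phi] => phi
  | phi :: s' => Or phi (bigor s')
  end.

(* The disjunction of a sequent, its formulas being listed in the order of the
   library enumeration of the multiset. *)
Definition bigvee (G : sequent) : form := bigor (enum_mset G).

(* t <= u, where z is the bound variable of the abbreviation. *)
Definition le (z : var) (t u : term) : form := Ex z (Eq (Add (Var z) t) u).

Inductive Delta0 : form -> Prop :=
| Delta0_eq t u : Delta0 (Eq t u)
| Delta0_neq t u : Delta0 (Neq t u)
| Delta0_and f g : Delta0 f -> Delta0 g -> Delta0 (And f g)
| Delta0_or f g : Delta0 f -> Delta0 g -> Delta0 (Or f g)
| Delta0_ball z y t f :
    z != y -> z \notin tvars t -> y \notin tvars t -> Delta0 f ->
    Delta0 (All y (imp (le z (Var y) t) f))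
| Delta0_bex z y t f :
    z != y -> z \notin tvars t -> y \notin tvars t -> Delta0 f ->
    Delta0 (Ex y (And (le z (Var y) t) f)).

Inductive ex_closure (C : form -> Prop) : form -> Prop :=
| exc_base f : C f -> ex_closure C f
| exc_and f g : ex_closure C f -> ex_closure C g -> ex_closure C (And f g)
| exc_or f g : ex_closure C f -> ex_closure C g -> ex_closure C (Or f g)
| exc_ex y f : ex_closure C f -> ex_closure C (Ex y f).

Inductive all_closure (C : form -> Prop) : form -> Prop :=
| allc_base f : C f -> all_closure C f
| allc_and f g : all_closure C f -> all_closure C g -> all_closure C (And f g)
| allc_or f g : all_closure C f -> all_closure C g -> all_closure C (Or f g)
| allc_all y f : all_closure C f -> all_closure C (All y f).

Fixpoint Sigma (n : nat) : form -> Prop :=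
  if n is m.+1 then ex_closure (Pi m) else Delta0
with Pi (n : nat) : form -> Prop :=
  if n is m.+1 then all_closure (Sigma m) else Delta0.

(* Provability in first-order logic with equality from a set T of axioms, by a
   one-sided (Tait) sequent calculus with cut; the formulas of the language are
   in negation normal form. *)
Inductive derivable (T : form -> Prop) : sequent -> Prop :=
| d_axiom G phi : T phi -> derivable T (G `+` [mset phi])
| d_id G phi : derivable T (G `+` [mset phi; neg phi])
| d_refl G t : derivable T (G `+` [mset Eq t t])
| d_repl G y t u phi :
    free_for y t phi -> free_for y u phi ->
    derivable T (G `+` [mset Neq t u; neg (subst y t phi); subst y u phi])
| d_and G phi psi :
    derivable T (G `+` [mset phi]) -> derivable T (G `+` [mset psi]) ->
    derivable T (G `+` [mset And phi psi])
| d_or G phi psi :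
    derivable T (G `+` [mset phi; psi]) -> derivable T (G `+` [mset Or phi psi])
| d_all G y phi z :
    free_for y (Var z) phi -> ~ in_FVs z (G `+` [mset All y phi]) ->
    derivable T (G `+` [mset subst y (Var z) phi]) ->
    derivable T (G `+` [mset All y phi])
| d_ex G y phi t :
    free_for y t phi ->
    derivable T (G `+` [mset subst y t phi]) ->
    derivable T (G `+` [mset Ex y phi])
| d_weak G D : derivable T G -> derivable T (G `+` D)
| d_contr G phi :
    derivable T (G `+` [mset phi; phi]) -> derivable T (G `+` [mset phi])
| d_cut G phi :
    derivable T (G `+` [mset phi]) -> derivable T (G `+` [mset neg phi]) ->
    derivable T G.

Definition proves (T : form -> Prop) (phi : form) : Prop :=
  derivable T [mset phi].

Definition univ_closure (phi : form) : form := foldr All phi (undup (FV phi)).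

Definition Q_axioms : seq form :=
  let x := Var 0 in let y := Var 1 in
  [:: neg (Eq (Succ x) Zero);
      imp (Eq (Succ x) (Succ y)) (Eq x y);
      Or (Eq x Zero) (Ex 1 (Eq x (Succ y)));
      Eq (Add x Zero) x;
      Eq (Add x (Succ y)) (Succ (Add x y));
      Eq (Mul x Zero) Zero;
      Eq (Mul x (Succ y)) (Add (Mul x y) x)].

Definition induction (x : var) (phi : form) : form :=
  imp (And (subst x Zero phi) (All x (imp phi (subst x (Succ (Var x)) phi))))
      (All x phi).

Inductive ISigma (n : nat) : form -> Prop :=
| ISigma_Q psi : psi \in Q_axioms -> ISigma n (univ_closure psi)
| ISigma_induction x phi : Sigma n phi -> ISigma n (univ_closure (induction x phi)).

Variant initial : sequent -> Prop :=
| init_id G t0 t1 : initial (G `+` [mset Eq t0 t1; Neq t0 t1])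
| init_succ G t : initial (G `+` [mset Neq (Succ t) Zero]).

(* Applications of the rules of SQ. The last argument of [AllR] and of [CaseR]
   is the active variable. *)
Inductive inference : Type :=
| AndR (G : sequent) (phi psi : form)
| OrR (G : sequent) (phi psi : form)
| AllR (G : sequent) (y : var) (phi : form) (z : var)
| ExR (G : sequent) (y : var) (phi : form) (t : term)
| RefR (G : sequent) (t : term)
| RepR (G : sequent) (t0 t1 : term) (y : var) (u0 u1 : term)
| Add0R (G : sequent) (t : term)
| AddSR (G : sequent) (t u : term)
| Mult0R (G : sequent) (t : term)
| MultSR (G : sequent) (t u : term)
| PredR (G : sequent) (t0 t1 : term)
| CaseR (G : sequent) (y : var)
| WeakR (G D : sequent)
| CutR (G : sequent) (phi : form).

Definition concl (r : inference) : sequent :=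
  match r with
  | AndR G phi psi => G `+` [mset And phi psi]
  | OrR G phi psi => G `+` [mset Or phi psi]
  | AllR G y phi z => G `+` [mset All y phi]
  | ExR G y phi t => G `+` [mset Ex y phi]
  | RefR G t => G
  | RepR G t0 t1 y u0 u1 => G `+` [mset Neq t0 t1; subst y t0 (Neq u0 u1)]
  | Add0R G t => G
  | AddSR G t u => G
  | Mult0R G t => G
  | MultSR G t u => G
  | PredR G t0 t1 => G `+` [mset Neq (Succ t0) (Succ t1)]
  | CaseR G y => G
  | WeakR G D => G `+` D
  | CutR G phi => G
  end.

(* The premisses, from left to right. *)
Definition prems (r : inference) : seq sequent :=
  match r with
  | AndR G phi psi => [:: G `+` [mset phi]; G `+` [mset psi]]
  | OrR G phi psi => [:: G `+` [mset phi; psi]]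
  | AllR G y phi z => [:: G `+` [mset subst y (Var z) phi]]
  | ExR G y phi t => [:: G `+` [mset subst y t phi; Ex y phi]]
  | RefR G t => [:: G `+` [mset Neq t t]]
  | RepR G t0 t1 y u0 u1 =>
      [:: G `+` [mset Neq t0 t1; subst y t0 (Neq u0 u1); subst y t1 (Neq u0 u1)]]
  | Add0R G t => [:: G `+` [mset Neq (Add t Zero) t]]
  | AddSR G t u => [:: G `+` [mset Neq (Add t (Succ u)) (Succ (Add t u))]]
  | Mult0R G t => [:: G `+` [mset Neq (Mul t Zero) Zero]]
  | MultSR G t u => [:: G `+` [mset Neq (Mul t (Succ u)) (Add (Mul t u) t)]]
  | PredR G t0 t1 => [:: G `+` [mset Neq (Succ t0) (Succ t1); Neq t0 t1]]
  | CaseR G y => [:: ssubst y Zero G; ssubst y (Succ (Var y)) G]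
  | WeakR G D => [:: G]
  | CutR G phi => [:: G `+` [mset phi]; G `+` [mset neg phi]]
  end.

Definition side_condition (r : inference) : Prop :=
  match r with
  | AllR G y phi z =>
      free_for y (Var z) phi /\ ~ in_FVs z (G `+` [mset All y phi])
  | ExR G y phi t => free_for y t phi
  | CaseR G y => in_FVs y G
  | _ => True
  end.

(* A possibly infinite tree with addresses in [seq nat]: the root is [::] and
   [rcons p i] is the i-th child of p, counted from 0. [mark p] is the sequent
   at the node p, or [None] if p is not a node of the tree, and [rule p] is the
   application whose conclusion is at p, or [None] if p is a leaf. *)
Record ptree : Type := PTree {
  mark : seq nat -> option sequent;
  rule : seq nat -> option inference
}.

Definition by_rules (P : ptree) : Prop :=
  mark P [::] <> None /\
  forall p : seq nat,
    match mark P p, rule P p with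
    | None, _ => forall i, mark P (rcons p i) = None
    | Some G, None => initial G /\ forall i, mark P (rcons p i) = None
    | Some G, Some r =>
        [/\ side_condition r, concl r = G
          & forall i, mark P (rcons p i) = onth (prems r) i]
    end.

(* An infinite branch is given by the successive choices b of premisses
   (0 is left and 1 is right); [mkseq b k] is its k-th node. *)
Definition infinite_branch (P : ptree) (b : nat -> nat) : Prop :=
  forall k, mark P (mkseq b k) <> None.

Definition rule_at (P : ptree) (b : nat -> nat) (k : nat) : option inference :=
  rule P (mkseq b k).

(* Conditions on the tail of the branch b which starts at its N-th node. *)

Definition tail_a (P : ptree) (b : nat -> nat) (N : nat) : Prop :=
  forall k G y, N <= k -> rule_at P b k = Some (CaseR G y) -> b k <> 0.

Definition tail_b (P : ptree) (b : nat -> nat) (N : nat) : Prop :=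
  forall k G z, N <= k -> rule_at P b k = Some (CaseR G z) -> b k = 1 ->
  forall j D y phi, k < j -> rule_at P b j <> Some (AllR D y phi z).

Definition tail_c (P : ptree) (b : nat -> nat) (N : nat) : Prop :=
  exists y, forall M, exists k G,
    [/\ N <= k, M <= k, rule_at P b k = Some (CaseR G y) & b k = 1].

Definition tail_d (P : ptree) (b : nat -> nat) (N m : nat) : Prop :=
  forall k G phi psi, N <= k -> rule_at P b k = Some (AndR G phi psi) ->
  (b k = 0 -> Pi m phi) /\ (b k = 1 -> Pi m psi).

Definition tail_e (P : ptree) (b : nat -> nat) (N m : nat) : Prop :=
  forall k G y phi z, N <= k -> rule_at P b k = Some (AllR G y phi z) ->
  Pi m (subst y (Var z) phi).

Definition tail_f (P : ptree) (b : nat -> nat) (N m : nat) : Prop :=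
  forall k G phi, N <= k -> rule_at P b k = Some (CutR G phi) ->
  (b k = 0 -> Pi m phi) /\ (b k = 1 -> Pi m (neg phi)).

Definition tail_g (P : ptree) (b : nat -> nat) (N m : nat) : Prop :=
  forall k G z, N <= k -> rule_at P b k = Some (CaseR G z) -> b k = 1 ->
  forall phi, phi \in G -> z \in FV phi -> Pi m phi.

Definition infty_proof (P : ptree) : Prop :=
  by_rules P /\
  forall b, infinite_branch P b ->
    exists N, [/\ tail_a P b N, tail_b P b N & tail_c P b N].

Definition Pi_restricted (m : nat) (P : ptree) : Prop :=
  forall b, infinite_branch P b ->
    exists N, [/\ tail_a P b N, tail_b P b N & tail_c P b N] /\
      [/\ tail_d P b N m, tail_e P b N m, tail_f P b N m & tail_g P b N m].

Definition isomorphic_subtrees (P : ptree) (p q : seq nat) : Prop :=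
  forall s, mark P (p ++ s) = mark P (q ++ s).

Definition regular (P : ptree) : Prop :=
  exists ps : seq (seq nat), forall p, mark P p <> None ->
    exists2 q, q \in ps & isomorphic_subtrees P p q.

Definition S_provable (n : nat) (G : sequent) : Prop :=
  exists P : ptree,
    [/\ infty_proof P, regular P, Pi_restricted n.+1 P & mark P [::] = Some G].

(* Main.v *)
From HB Require Import structures.
From mathcomp Require Import all_boot.
From mathcomp Require Import finmap multiset.
From mathcomp Require Import boolp.
Require Import Defs.

Set Implicit Arguments.
Unset Strict Implicit.
Unset Printing Implicit Defensive.

Local Open Scope mset_scope.

(* A regular proof is a finite graph of sequents. If some of its sequents were
   not derivable in ISigma_(n+1), the underivable ones would contain a strongly
   connected set C all of whose exits are derivable. A walk through all edges of
   C shows that C contains no left premiss of (case), and that the set Z of the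
   variables on which (case) acts inside C is disjoint from the eigenvariables
   of C. Hence, read from conclusion to premiss, a refuting assignment moves
   around C without changing the values of Z, except that (case) decreases one of
   them; and no cycle of C avoids (case). If the values of Z initially have sum a,
   this sum would then decrease more than a times, which is impossible. The descent
   is an induction on a formula Psi(u) stating that some sequent of C is refuted by
   an assignment for which Z has sum a - u. The formulas of the sequents
   of C that are not Pi_(n+1) imply formulas which belong to all sequents of C
   and contain neither variables of Z nor eigenvariables; these are kept as
   parameters outside Psi, and Psi becomes Sigma_(n+1). *)

(** * Syntax *)

(** Regularity compares sequents only, so isomorphic nodes may carry different rules, and sequents
    do not determine an eigenvariable: when y is not free in φ, every admissible z gives the same
    premiss of ∀y φ. The finite graph therefore has no rules of its own; they are read off one
    branch of the proof that repeats a closed walk through C forever. Two-premiss rules are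
    determined by their conclusion and premisses, so what one period of the branch shows about them
    holds for the graph. Eigenvariables are read from positions after the period that supplies Z,
    because (b) restricts only the applications of (∀) that come after (case). Condition (c) is
    applied to the other walks in C too: a walk without (case) would be traced by a branch violating
    it, so between two decreases of the sum the search for a refuted premiss terminates. *)

Lemma negK : involutive neg.
Proof. by elim=> //= [f -> g ->|f -> g ->|y f ->|y f ->]. Qed.

Lemma neg_subst y t phi : subst y t (neg phi) = neg (subst y t phi).
Proof.
by elim: phi => //= [f -> g ->|f -> g ->|x f IH|x f IH] //; case: ifP; rewrite //= IH.
Qed.

Lemma FV_neg phi : FV (neg phi) = FV phi.
Proof. by elim: phi => //= [f -> g ->|f -> g ->|x f ->|x f ->]. Qed.

Lemma tsubst_var y u : tsubst y (Var y) u = u.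
Proof. by elim: u => //= [x|u ->|u -> v ->|u -> v ->] //; case: eqP => [->|]. Qed.

Lemma subst_var y phi : subst y (Var y) phi = phi.
Proof.
by elim: phi => //= [t u|t u|f -> g ->|f -> g ->|x f ->|x f ->];
  rewrite ?tsubst_var // if_same.
Qed.

Lemma tsubst_notin y t u : y \notin tvars u -> tsubst y t u = u.
Proof.
elim: u => //= [x|u IH|u IHu v IHv|u IHu v IHv].
- by rewrite inE eq_sym; case: eqP.
- by move/IH ->.
- by rewrite mem_cat => /norP[/IHu -> /IHv ->].
- by rewrite mem_cat => /norP[/IHu -> /IHv ->].
Qed.

Lemma subst_notin y t phi : y \notin FV phi -> subst y t phi = phi.
Proof.
elim: phi => //= [u v|u v|f IHf g IHg|f IHf g IHg|x f IH|x f IH].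
- by rewrite mem_cat => /norP[/tsubst_notin -> /tsubst_notin ->].
- by rewrite mem_cat => /norP[/tsubst_notin -> /tsubst_notin ->].
- by rewrite mem_cat => /norP[/IHf -> /IHg ->].
- by rewrite mem_cat => /norP[/IHf -> /IHg ->].
- by rewrite mem_filter eq_sym; case: eqP => //= _ /IH ->.
- by rewrite mem_filter eq_sym; case: eqP => //= _ /IH ->.
Qed.

Lemma free_for_self y t phi : {subset tvars t <= [:: y]} -> free_for y t phi.
Proof.
move=> sub; elim: phi => //= [f -> g ->|f -> g ->|x f ->|x f ->] //; rewrite andbT.
- case: (x =P y) => [->|ne]; first by rewrite mem_filter eqxx.
  by apply/orP; right; apply: contra_notN ne => /sub; rewrite inE => /eqP.
- case: (x =P y) => [->|ne]; first by rewrite mem_filter eqxx.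
  by apply/orP; right; apply: contra_notN ne => /sub; rewrite inE => /eqP.
Qed.

Lemma free_for_var y phi : free_for y (Var y) phi.
Proof. exact: free_for_self. Qed.

Lemma free_for_notin y t phi : y \notin FV phi -> free_for y t phi.
Proof.
elim: phi => //= [f IHf g IHg|f IHf g IHg|x f IH ->|x f IH ->] //;
  by rewrite mem_cat => /norP[/IHf -> /IHg ->].
Qed.

Lemma free_for_neg y t phi : free_for y t (neg phi) = free_for y t phi.
Proof.
by elim: phi => //= [f -> g ->|f -> g ->|x f ->|x f ->] //; rewrite FV_neg.
Qed.

Lemma mem_FV_All x y f : (x \in FV (All y f)) = (x != y) && (x \in FV f).
Proof. exact: mem_filter. Qed.

Lemma mem_FV_Ex x y f : (x \in FV (Ex y f)) = (x != y) && (x \in FV f).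
Proof. exact: mem_filter. Qed.

Lemma free_for_All y t x f : y \in FV (All x f) ->
  free_for y t (All x f) = (x \notin tvars t) && free_for y t f.
Proof. by move=> H /=; move: H; rewrite /= => ->. Qed.

Lemma free_for_Ex y t x f : y \in FV (Ex x f) ->
  free_for y t (Ex x f) = (x \notin tvars t) && free_for y t f.
Proof. exact: free_for_All. Qed.

Fixpoint bv (phi : form) : seq var :=
  match phi with
  | Eq _ _ | Neq _ _ => [::]
  | And f g | Or f g => bv f ++ bv g
  | All y f | Ex y f => y :: bv f
  end.

Lemma bv_subst y t phi : bv (subst y t phi) = bv phi.
Proof.
by elim: phi => //= [f -> g ->|f -> g ->|x f IH|x f IH] //; case: ifP; rewrite //= IH.
Qed.

Lemma free_for_bv y t phi :
  {in tvars t, forall x, x \notin bv phi} -> free_for y t phi.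
Proof.
elim: phi => //= [f IHf g IHg|f IHf g IHg|x f IH|x f IH] H.
- by rewrite IHf ?IHg // => x /H; rewrite mem_cat => /norP[].
- by rewrite IHf ?IHg // => x /H; rewrite mem_cat => /norP[].
- rewrite IH ?andbT; last by move=> z /H; rewrite inE => /norP[].
  by apply/orP; right; apply/negP => /H; rewrite inE eqxx.
- rewrite IH ?andbT; last by move=> z /H; rewrite inE => /norP[].
  by apply/orP; right; apply/negP => /H; rewrite inE eqxx.
Qed.

Lemma tsubst_subst y t w u :
  tsubst y t (tsubst y u w) = tsubst y (tsubst y t u) w.
Proof.
elim: w => //= [x|w ->|w -> v ->|w -> v ->] //.
by case: ifP => //= ->.
Qed.

Lemma subst_subst y t u phi :
  subst y t (subst y u phi) = subst y (tsubst y t u) phi.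
Proof.
elim: phi => //= [v w|v w|f -> g ->|f -> g ->|x f IH|x f IH];
  rewrite ?tsubst_subst //; by case: ifP => /= ->; rewrite ?IH.
Qed.

Lemma tvars_tsubst x y t u :
  x \in tvars (tsubst y t u) -> (x \in tvars t) || ((x != y) && (x \in tvars u)).
Proof.
elim: u => //= [z|u IHu v IHv|u IHu v IHv].
- case: ifP => [_ -> //|/negbT ne] /=; rewrite inE => /eqP ->.
  by rewrite ne eqxx orbT.
- by rewrite !mem_cat => /orP[/IHu|/IHv]/orP[->//|/andP[->->]]; rewrite ?orbT.
- by rewrite !mem_cat => /orP[/IHu|/IHv]/orP[->//|/andP[->->]]; rewrite ?orbT.
Qed.

Lemma tvars_tsubst_ne x y t u :
  x != y -> x \in tvars u -> x \in tvars (tsubst y t u).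
Proof.
move=> ne; elim: u => //= [z|u IHu v IHv|u IHu v IHv].
- by rewrite inE => /eqP <-; rewrite (negbTE ne) inE.
- by rewrite !mem_cat => /orP[/IHu|/IHv] ->; rewrite ?orbT.
- by rewrite !mem_cat => /orP[/IHu|/IHv] ->; rewrite ?orbT.
Qed.

Lemma FV_subst_ne x y t phi : x != y -> x \in FV phi -> x \in FV (subst y t phi).
Proof.
move=> ne; elim: phi => //= [u v|u v|f IHf g IHg|f IHf g IHg|z f IH|z f IH].
1,2: by rewrite !mem_cat => /orP[]/(tvars_tsubst_ne t ne) ->; rewrite ?orbT.
1,2: by rewrite !mem_cat => /orP[/IHf|/IHg] ->; rewrite ?orbT.
1,2: by case: ifP => //= _; rewrite !mem_filter => /andP[-> /IH].
Qed.

Lemma FV_subst_Zero y phi : y \notin FV (subst y Zero phi).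
Proof.
have T u : y \notin tvars (tsubst y Zero u).
  by apply/negP => /tvars_tsubst /=; rewrite eqxx.
elim: phi => //= [u v|u v|f IHf g IHg|f IHf g IHg|z f IH|z f IH].
1,2,3,4: by rewrite mem_cat negb_or ?T // IHf IHg.
1,2: by case: ifP => [/eqP -> /=|_ /=]; rewrite mem_filter ?eqxx // negb_and IH orbT.
Qed.

Lemma fresh_var (s : seq var) : exists x, x \notin s.
Proof.
have H x : x \in s -> x <= foldr maxn 0 s.
  elim: s => //= y s IH; rewrite in_cons leq_max => /orP[/eqP ->|/IH ->].
    by rewrite leqnn.
  by rewrite orbT.
by exists (foldr maxn 0 s).+1; apply/negP => /H; rewrite ltnn.
Qed.

(** Unlike [bigor] it ends in [bot] also for nonempty lists, so that inductions have a single base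
    case; [neg bot] is an instance of reflexivity. *)
Definition disj (s : seq form) : form := foldr Or bot s.

Lemma FV_disj x s : x \in FV (disj s) -> exists2 phi, phi \in s & x \in FV phi.
Proof.
elim: s => //= f s IH; rewrite mem_cat => /orP[H|/IH[g gs xg]].
  by exists f; rewrite // mem_head.
by exists g; rewrite // inE gs orbT.
Qed.

Lemma FV_foldr_Ex X phi x :
  (x \in FV (foldr Ex phi X)) = (x \notin X) && (x \in FV phi).
Proof. by elim: X => //= y X IH; rewrite mem_filter IH inE negb_or andbA. Qed.

Lemma neg_foldr_Ex X phi : neg (foldr Ex phi X) = foldr All (neg phi) X.
Proof. by elim: X => //= y X ->. Qed.

Lemma subst_foldr_Ex x t X phi :
  x \notin X -> subst x t (foldr Ex phi X) = foldr Ex (subst x t phi) X.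
Proof.
by elim: X => //= y X IH; rewrite inE negb_or eq_sym => /andP[/negbTE -> /IH ->].
Qed.

Lemma mem_tl (x y : form) (s : seq form) : x \in s -> x \in y :: s.
Proof. by rewrite in_cons orbC => ->. Qed.

Lemma mem_catl (x : form) (s t : seq form) : x \in s -> x \in s ++ t.
Proof. by rewrite mem_cat => ->. Qed.

Lemma mem_catr (x : form) (s t : seq form) : x \in t -> x \in s ++ t.
Proof. by rewrite mem_cat orbC => ->. Qed.

Lemma sub_nil (t : seq form) : {subset [::] <= t}.
Proof. by []. Qed.

Lemma sub_cons (x : form) (s t : seq form) : x \in t -> {subset s <= t} -> {subset x :: s <= t}.
Proof. by move=> xt st y; rewrite in_cons => /orP[/eqP ->|/st]. Qed.

Lemma sub_cat (s1 s2 t : seq form) :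
  {subset s1 <= t} -> {subset s2 <= t} -> {subset s1 ++ s2 <= t}.
Proof. by move=> s1t s2t y; rewrite mem_cat => /orP[/s1t|/s2t]. Qed.

Lemma sub_tl (x : form) (s t : seq form) : {subset s <= t} -> {subset s <= x :: t}.
Proof. by move=> st y /st; apply: mem_tl. Qed.

Lemma sub_catl (s t1 t2 : seq form) : {subset s <= t1} -> {subset s <= t1 ++ t2}.
Proof. by move=> st y /st; apply: mem_catl. Qed.

Lemma sub_catr (s t1 t2 : seq form) : {subset s <= t2} -> {subset s <= t1 ++ t2}.
Proof. by move=> st y /st; apply: mem_catr. Qed.

(* The boolean equality of [form] goes through numeric codes, which must never
   be computed: these tactics compare formulas syntactically. *)
Ltac mem_syn :=
  match goal with
  | H : is_true (@in_mem _ ?a (@mem _ _ ?s)) |- is_true (@in_mem _ ?b (@mem _ _ ?t)) =>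
      constr_eq a b; constr_eq s t; exact H
  | |- is_true (@in_mem _ ?a (@mem _ _ (?b :: ?s))) => constr_eq a b; exact (mem_head a s)
  | |- is_true (@in_mem _ ?a (@mem _ _ (?b :: ?s))) => refine (@mem_tl a b s _); mem_syn
  | |- is_true (@in_mem _ ?a (@mem _ _ (?s ++ ?t))) =>
      first [ refine (@mem_catl a s t _); mem_syn | refine (@mem_catr a s t _); mem_syn ]
  end.
Ltac sub_syn :=
  match goal with
  | |- sub_mem (@mem _ _ ?s) (@mem _ _ ?t) => constr_eq s t; exact (fun _ h => h)
  | |- sub_mem _ (@mem _ _ (?b :: ?t)) => refine (@sub_tl b _ t _); sub_syn
  | |- sub_mem _ (@mem _ _ (?t1 ++ ?t2)) =>
      first [ refine (@sub_catl _ t1 t2 _); sub_syn | refine (@sub_catr _ t1 t2 _); sub_syn ]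
  end.
Ltac mem := cbn [neg]; mem_syn.
Ltac submem :=
  cbn [neg];
  match goal with
  | |- sub_mem (@mem _ _ [::]) (@mem _ _ ?t) => exact (@sub_nil t)
  | |- sub_mem (@mem _ _ (?a :: ?s)) (@mem _ _ ?t) =>
      refine (@sub_cons a s t _ _); [mem_syn | submem]
  | |- sub_mem (@mem _ _ (?s1 ++ ?s2)) (@mem _ _ ?t) =>
      refine (@sub_cat s1 s2 t _ _); submem
  | |- _ => sub_syn
  end.

(** * Derivability *)

Section FirstOrder.

Variable T : form -> Prop.

(* A [Variant] rather than a definition, so that unification never unfolds
   the underlying multiset. *)
Variant prov (s : seq form) : Prop := Prov of derivable T (seq_mset s).

Lemma provE s : prov s <-> derivable T (seq_mset s).
Proof. by split=> [[]|]. Qed.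

Lemma prov_enum G : prov (enum_mset G) <-> derivable T G.
Proof. by rewrite provE seq_mset_id. Qed.

Lemma prov_perm s s' : perm_eq s s' -> prov s -> prov s'.
Proof. by rewrite !provE => /eq_seq_msetP ->. Qed.

Lemma prov_cons phi s :
  prov (phi :: s) <-> derivable T (seq_mset s `+` [mset phi]).
Proof. by rewrite provE mset_cons msetDC. Qed.

Lemma prov_cons2 phi psi s :
  prov (phi :: psi :: s) <-> derivable T (seq_mset s `+` [mset phi; psi]).
Proof. by rewrite provE !mset_cons msetDA msetDC. Qed.

Lemma prov_contract phi s : phi \in s -> prov (phi :: s) -> prov s.
Proof.
move=> ins H; have e := perm_to_rem ins.
apply: (prov_perm (s := phi :: rem phi s)); first by rewrite perm_sym.
apply/prov_cons/d_contr/prov_cons2.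
by apply: prov_perm H; rewrite perm_cons.
Qed.

(** Weaken by all of [s'], then contract the formulas of [s] away: provability depends only on the
    set of formulas listed. *)
Lemma prov_sub s s' : {subset s <= s'} -> prov s -> prov s'.
Proof.
move=> sub H.
have {H} : prov (s ++ s').
  apply/provE; suff -> : seq_mset (s ++ s') = seq_mset s `+` seq_mset s' by apply/d_weak/provE.
  elim: s {sub H} => [|f s IH]; last by rewrite /= !mset_cons IH msetDA.
  by rewrite /= -[LHS]mset0D; congr (_ `+` _); apply/msetP => x; rewrite mset_seqE mset0E.
elim: s sub => //= f s IH sub H; apply: IH.
  by move=> x xs; apply: sub; rewrite in_cons xs orbT.
by apply: prov_contract H; rewrite mem_cat sub ?mem_head ?orbT.
Qed.

Lemma prov_ax phi s : T phi -> phi \in s -> prov s.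
Proof.
move=> Tphi ins; apply: (prov_sub (s := [:: phi])); first by move=> x; rewrite mem_seq1 => /eqP ->.
exact/prov_cons/d_axiom.
Qed.

Lemma prov_id phi s : phi \in s -> neg phi \in s -> prov s.
Proof.
move=> ins ins'; apply: (prov_sub (s := [:: phi; neg phi])).
  by move=> x; rewrite !inE => /orP[]/eqP ->.
exact/prov_cons2/d_id.
Qed.

Lemma prov_refl t s : Eq t t \in s -> prov s.
Proof.
move=> ins; apply: (prov_sub (s := [:: Eq t t])); first by move=> x; rewrite mem_seq1 => /eqP ->.
exact/prov_cons/d_refl.
Qed.

Lemma prov_cut phi s : prov (phi :: s) -> prov (neg phi :: s) -> prov s.
Proof. by move=> /prov_cons H1 /prov_cons H2; apply/provE/(d_cut H1 H2). Qed.

Lemma prov_repl y t u phi s :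
  free_for y t phi -> free_for y u phi ->
  Neq t u \in s -> neg (subst y t phi) \in s -> subst y u phi \in s -> prov s.
Proof.
move=> ft fu i1 i2 i3.
apply: (prov_sub (s := [:: Neq t u; neg (subst y t phi); subst y u phi])).
  by move=> x; rewrite !inE => /or3P[]/eqP ->.
apply/provE; rewrite !mset_cons.
have -> : Neq t u +` (neg (subst y t phi) +` (subst y u phi +` seq_mset [::])) =
   seq_mset [::] `+` [mset Neq t u; neg (subst y t phi); subst y u phi].
  by rewrite [RHS]msetDC !msetDA.
exact: (d_repl T _ ft fu).
Qed.

Lemma prov_and phi psi s :
  And phi psi \in s -> prov (phi :: s) -> prov (psi :: s) -> prov s.
Proof.
move=> ins /prov_cons H1 /prov_cons H2; apply: (prov_contract ins).
exact/prov_cons/d_and.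
Qed.

Lemma prov_or phi psi s : Or phi psi \in s -> prov (phi :: psi :: s) -> prov s.
Proof.
by move=> ins /prov_cons2 H; apply: (prov_contract ins); apply/prov_cons/d_or.
Qed.

Lemma prov_all y phi z s :
  All y phi \in s -> free_for y (Var z) phi -> {in s, forall psi, z \notin FV psi} ->
  prov (subst y (Var z) phi :: s) -> prov s.
Proof.
move=> ins ff nz /prov_cons H; apply: (prov_contract ins); apply/prov_cons.
apply: (d_all ff) H => -[psi]; rewrite in_msetD in_mset1 (perm_mem (perm_eq_seq_mset s)).
by case/orP=> [/nz/negbTE->|/eqP ->] //; rewrite (negbTE (nz _ ins)).
Qed.

Lemma prov_allI y phi s :
  {in s, forall psi, y \notin FV psi} -> prov (phi :: s) -> prov (All y phi :: s).
Proof.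
move=> ny H; apply: (prov_all (y := y) (z := y) (phi := phi)); rewrite ?mem_head ?free_for_var //.
  by move=> psi; rewrite in_cons => /orP[/eqP -> /=|/ny//]; rewrite mem_filter eqxx.
rewrite subst_var; apply: prov_sub H; submem.
Qed.

Lemma prov_ex y phi t s :
  Ex y phi \in s -> free_for y t phi -> prov (subst y t phi :: s) -> prov s.
Proof.
move=> ins ff /prov_cons H; apply: (prov_contract ins); apply/prov_cons.
exact: d_ex H.
Qed.

Lemma prov_exI y phi s : prov (phi :: s) -> prov (Ex y phi :: s).
Proof.
move=> H; apply: (prov_ex (y := y) (t := Var y) (phi := phi)); rewrite ?mem_head ?free_for_var //.
rewrite subst_var; apply: prov_sub H; submem.
Qed.

(** The elimination rule for a proved disjunction. Axioms and earlier results enter later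
    derivations through it. *)
Lemma prov_cuts s r :
  prov s -> {in s, forall phi, prov (neg phi :: r)} -> prov r.
Proof.
move=> H cuts; have {H} : prov (s ++ r).
  by apply: prov_sub H => x xs; rewrite mem_cat xs.
elim: s cuts => //= f s IH cuts H; apply: IH.
  by move=> x xs; apply: cuts; rewrite in_cons xs orbT.
apply: prov_cut H _; apply: prov_sub (cuts f (mem_head _ _)); submem.
Qed.

Lemma prov_disj s r : prov (s ++ r) -> prov (disj s :: r).
Proof.
elim: s r => [|f s IH] r H /=; first by apply: prov_sub H => x xr; rewrite in_cons xr orbT.
apply: (prov_or (mem_head _ _)).
apply: (prov_sub (s := disj s :: f :: r)).
  submem.
by apply: IH; apply: prov_sub H; submem.
Qed.

Lemma prov_neg_disj s r :
  {in s, forall phi, prov (neg phi :: r)} -> prov (neg (disj s) :: r).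
Proof.
elim: s => [_|f s IH H] /=; first by apply: (@prov_refl Zero); rewrite mem_head.
apply: (prov_and (mem_head _ _)).
  apply: prov_sub (H f (mem_head _ _)); submem.
apply: (prov_sub (s := neg (disj s) :: r)); first submem.
by apply: IH => g gs; apply: H; mem.
Qed.

Lemma prov_mem_disj phi s r : phi \in s -> prov (phi :: r) -> prov (disj s :: r).
Proof.
move=> ins H; apply: prov_disj; apply: prov_sub H => x.
by rewrite in_cons mem_cat => /orP[/eqP->|->]; [rewrite ins|exact: orbT].
Qed.

(** Universally quantifying the disjunction of [s] and instantiating it by a cut avoids an induction
    on derivations, in which eigenvariables would have to be renamed. *)
Lemma prov_subst y t s :
  {in s, forall phi, free_for y t phi} -> prov s -> prov [seq subst y t phi | phi <- s].
Proof.
move=> ff H.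
have {H} : prov [:: All y (disj s)].
  by apply: prov_allI => //; apply: prov_disj; rewrite cats0.
move=> H; apply: (prov_cuts H) => phi; rewrite mem_seq1 => /eqP -> /=.
apply: (prov_ex (mem_head _ _) (t := t)).
  elim: s ff {H} => //= f s IH ff.
  by rewrite free_for_neg ff ?mem_head ?IH // => x xs; apply: ff; rewrite in_cons xs orbT.
have -> : subst y t (neg (disj s)) = neg (disj [seq subst y t phi | phi <- s]).
  by rewrite neg_subst; congr neg; elim: s {ff H} => //= f s ->.
apply: prov_neg_disj => f fs; apply: (@prov_id f); last exact: mem_head.
mem.
Qed.

Lemma prov_inst X phi r : prov (neg phi :: r) -> prov (neg (foldr All phi X) :: r).
Proof. by move=> H; elim: X => //= y X IH; apply: prov_exI. Qed.

Lemma prov_closed X phi : T (foldr All phi X) -> prov [:: phi].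
Proof.
move=> Tphi; apply: (@prov_cut (foldr All phi X)).
  by apply: (prov_ax Tphi); rewrite mem_head.
by apply: prov_inst; apply: (@prov_id phi); mem.
Qed.

Lemma prov_foldr_All X phi s :
  {in s, forall psi, {in X, forall x, x \notin FV psi}} ->
  prov (phi :: s) -> prov (foldr All phi X :: s).
Proof.
move=> H Hp; elim: X H => //= y X IH H; apply: prov_allI.
  by move=> psi ps; apply: H => //; rewrite mem_head.
by apply: IH => psi ps x xX; apply: H => //; rewrite in_cons xX orbT.
Qed.

Lemma prov_foldr_Ex X phi s : prov (phi :: s) -> prov (foldr Ex phi X :: s).
Proof. by move=> H; elim: X => //= y X IH; apply: prov_exI. Qed.

Lemma prov_bigor s : prov s -> prov [:: bigor s].
Proof.
case: s => [|f s]; first exact: prov_sub.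
suff H r : prov (f :: s ++ r) -> prov (bigor (f :: s) :: r).
  by move=> Hs; apply: H; rewrite cats0.
elim: s f r => [//|g s IH] f r H.
apply: (prov_or (phi := f) (psi := bigor (g :: s))); first exact: mem_head.
apply: (prov_sub (s := bigor (g :: s) :: f :: r)).
  submem.
apply: IH; apply: prov_sub H; submem.
Qed.

End FirstOrder.

(** * Equality and arithmetic *)

Section Equality.

Variable T : form -> Prop.
Notation prov := (prov T).

Lemma prov_weak phi s : prov [:: phi] -> prov (phi :: s).
Proof. by apply: prov_sub; submem. Qed.

Lemma prov_mp phi psi s : prov (phi :: s) -> prov (neg phi :: psi :: s) -> prov (psi :: s).
Proof. by move=> H; apply: prov_cut; apply: prov_sub H; submem. Qed.

Lemma prov_leibniz y t u phi s :
  free_for y t phi -> free_for y u phi ->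
  prov (Eq t u :: s) -> prov (subst y t phi :: s) -> prov (subst y u phi :: s).
Proof.
move=> ft fu e H; apply: (prov_mp e) => /=; apply: (@prov_cut _ (subst y t phi)).
  by apply: prov_sub H; submem.
by apply: (prov_repl _ ft fu); mem.
Qed.

Lemma prov_sym t u s : prov (Eq t u :: s) -> prov (Eq u t :: s).
Proof.
move=> e; have [v vt] := fresh_var (tvars t).
have /= := @prov_leibniz v t u (Eq (Var v) t) s isT isT e.
rewrite eqxx !tsubst_notin //; apply.
by apply: (@prov_refl _ t); mem.
Qed.

Lemma prov_trans t u v s : prov (Eq t u :: s) -> prov (Eq u v :: s) -> prov (Eq t v :: s).
Proof.
move=> e1 e2; have [w wt] := fresh_var (tvars t).
have /= := @prov_leibniz w u v (Eq t (Var w)) s isT isT e2.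
by rewrite eqxx !tsubst_notin //; apply.
Qed.

(** The left side of the equation must stay fixed while the right side varies, so the hole on the
    right is renamed to a fresh [v]. *)
Lemma prov_eq_context w c t u s :
  prov (Eq t u :: s) -> prov (Eq (tsubst w t c) (tsubst w u c) :: s).
Proof.
move=> e; have [v] := fresh_var (tvars (tsubst w t c) ++ tvars c).
rewrite mem_cat => /norP[v1 v2].
have /= := @prov_leibniz v t u (Eq (tsubst w t c) (tsubst w (Var v) c)) s isT isT e.
have E t' : tsubst v t' (tsubst w (Var v) c) = tsubst w t' c.
  elim: c v2 {v1} => //= [x|c IH|c1 IH1 c2 IH2|c1 IH1 c2 IH2].
  - by case: ifP => //= _; rewrite ?eqxx // mem_seq1 eq_sym => /negbTE ->.
  - by move/IH ->.
  - by rewrite mem_cat => /norP[/IH1 -> /IH2 ->].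
  - by rewrite mem_cat => /norP[/IH1 -> /IH2 ->].
rewrite !E !(tsubst_notin _ v1); apply.
by apply: (@prov_refl _ (tsubst w t c)); mem.
Qed.

Lemma prov_eq_Succ t u s : prov (Eq t u :: s) -> prov (Eq (Succ t) (Succ u) :: s).
Proof. by move=> /(prov_eq_context 0 (Succ (Var 0))). Qed.

Lemma prov_eq_Add t u t' u' s :
  prov (Eq t u :: s) -> prov (Eq t' u' :: s) -> prov (Eq (Add t t') (Add u u') :: s).
Proof.
move=> e e'; have [w] := fresh_var (tvars t ++ tvars u').
rewrite mem_cat => /norP[wt wu].
have /= := prov_eq_context w (Add t (Var w)) e'; rewrite eqxx !tsubst_notin // => e1.
have /= := prov_eq_context w (Add (Var w) u') e; rewrite eqxx !tsubst_notin // => e2.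
exact: prov_trans e1 e2.
Qed.

Lemma prov_eq_refl t s : prov (Eq t t :: s).
Proof. by apply: (@prov_refl _ t); mem. Qed.

Lemma prov_eq_hyp t u s : Neq t u \in s -> prov (Eq t u :: s).
Proof. by move=> H; apply: (@prov_id _ (Eq t u)); mem. Qed.

Lemma prov_neq_context t u t' u' s :
  prov (Eq t t' :: s) -> prov (Eq u u' :: s) -> prov (Neq t u :: s) -> prov (Neq t' u' :: s).
Proof.
move=> e1 e2 H; apply: (prov_mp H) => /=.
apply: (prov_sub (s := Eq t u :: Neq t' u' :: s)); first submem.
have W v w : prov (Eq v w :: s) -> prov (Eq v w :: Neq t' u' :: s).
  by move=> H'; apply: prov_sub H'; submem.
apply: prov_trans (W _ _ e1) _; apply: prov_trans (prov_sym (W _ _ e2)).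
by apply: prov_eq_hyp; mem.
Qed.

Lemma prov_eq_subst y t s :
  {in s, forall phi, free_for y t phi} ->
  prov [seq subst y t phi | phi <- s] -> prov (Neq (Var y) t :: s).
Proof.
move=> ff H; apply: (prov_cuts H) => psi /mapP[phi ps ->].
have e : prov (Eq t (Var y) :: neg (subst y t phi) :: Neq (Var y) t :: s).
  by apply: prov_sym; apply: prov_eq_hyp; mem.
apply: (prov_cut e) => /=.
apply: (prov_repl _ (ff _ ps) (free_for_var y phi)); rewrite ?subst_var; mem.
Qed.

Lemma prov_subst1 y t phi : bv phi = [::] -> prov [:: phi] -> prov [:: subst y t phi].
Proof.
move=> b; apply: (@prov_subst _ y t [:: phi]) => f; rewrite mem_seq1 => /eqP ->.
by apply: free_for_bv; rewrite b.
Qed.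

End Equality.

Lemma Sigma_Pi_atomic k t u :
  (Sigma k (Eq t u) * Sigma k (Neq t u)) * (Pi k (Eq t u) * Pi k (Neq t u)).
Proof.
elim: k => [|k [[? ?] [? ?]]] /=; first by do ![split]; constructor.
by do ![split]; [exact: exc_base|exact: exc_base|exact: allc_base|exact: allc_base].
Qed.

Section Arithmetic.

Variable k : nat.
Notation prov := (prov (ISigma k)).

Lemma prov_Q psi : psi \in Q_axioms -> prov [:: psi].
Proof. by move=> H; apply: (@prov_closed _ (undup (FV psi))); apply: ISigma_Q. Qed.

(** The variable 1 of the axiom is first renamed to a fresh [w], so that the later substitution of
    [u] cannot touch an occurrence of 1 inside [t]. *)
Lemma prov_Q_inst i t u (psi := nth bot Q_axioms i) :
  i < size Q_axioms -> bv psi = [::] ->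
  exists w, [/\ w \notin tvars t, (w == 0) = false, (w == 1) = false &
    prov [:: subst w u (subst 0 t (subst 1 (Var w) psi))]].
Proof.
move=> /(mem_nth bot)/prov_Q H b; have [w] := fresh_var (0 :: 1 :: tvars t).
rewrite !in_cons !negb_or => /and3P[/negbTE w0 /negbTE w1 wt]; exists w; split=> //.
by do 3![apply: prov_subst1; first by rewrite ?bv_subst b].
Qed.

Lemma Q_succ t s : prov (Neq (Succ t) Zero :: s).
Proof.
apply: prov_weak; have [w [wt w0 w1]] := @prov_Q_inst 0 t t isT erefl.
by rewrite /= tsubst_notin.
Qed.

Lemma Q_inj t u s : prov (Eq (Succ t) (Succ u) :: s) -> prov (Eq t u :: s).
Proof.
move=> e; apply: (prov_mp e) => /=.
have [w [wt w0 w1]] := @prov_Q_inst 1 t u isT erefl.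
rewrite /= w0 /= eqxx !tsubst_notin // => H.
apply: (prov_cuts H) => f; rewrite mem_seq1 => /eqP -> /=.
apply: (prov_and (mem_head _ _)).
  by apply: (@prov_id _ (Eq (Succ t) (Succ u))); mem.
by apply: (@prov_id _ (Eq t u)); mem.
Qed.

Lemma Q_add0 t s : prov (Eq (Add t Zero) t :: s).
Proof.
apply: prov_weak; have [w [wt w0 w1]] := @prov_Q_inst 3 t t isT erefl.
by rewrite /= !tsubst_notin.
Qed.

Lemma Q_addS t u s : prov (Eq (Add t (Succ u)) (Succ (Add t u)) :: s).
Proof.
apply: prov_weak; have [w [wt w0 w1]] := @prov_Q_inst 4 t u isT erefl.
by rewrite /= w0 /= eqxx !tsubst_notin.
Qed.

Lemma Q_mul0 t s : prov (Eq (Mul t Zero) Zero :: s).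
Proof.
apply: prov_weak; have [w [wt w0 w1]] := @prov_Q_inst 5 t t isT erefl.
by rewrite /= !tsubst_notin.
Qed.

Lemma Q_mulS t u s : prov (Eq (Mul t (Succ u)) (Add (Mul t u) t) :: s).
Proof.
apply: prov_weak; have [w [wt w0 w1]] := @prov_Q_inst 6 t u isT erefl.
by rewrite /= w0 /= eqxx !tsubst_notin.
Qed.

Lemma Q_case y w : w != y ->
  prov [:: Or (Eq (Var y) Zero) (Ex w (Eq (Var y) (Succ (Var w))))].
Proof.
(* The axiom has 0 free and 1 bound, while [y] may be 1 and [w] may be 0. Passing through [v]
   separates the change of the bound variable from that of the free one. *)
move=> wy; have [v] := fresh_var [:: 0; 1; w].
rewrite !in_cons in_nil orbF !negb_or => /and3P[/negbTE v0 /negbTE v1 /negbTE vw].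
have H : prov [:: Or (Eq (Var v) Zero) (Ex 1 (Eq (Var v) (Succ (Var 1))))].
  have ff : {in [:: nth bot Q_axioms 2], forall phi, free_for 0 (Var v) phi}.
    by move=> f; rewrite mem_seq1 => /eqP -> /=; rewrite mem_seq1 eq_sym v1.
  exact: (prov_subst ff (prov_Q (mem_nth bot (isT : 2 < size Q_axioms)))).
have {}H : prov [:: Or (Eq (Var v) Zero) (Ex w (Eq (Var v) (Succ (Var w))))].
  apply: (prov_cuts H) => f; rewrite mem_seq1 => /eqP -> /=.
  apply: (@prov_or _ (Eq (Var v) Zero) (Ex w (Eq (Var v) (Succ (Var w))))); first mem.
  apply: (@prov_and _ (Neq (Var v) Zero) (All 1 (Neq (Var v) (Succ (Var 1))))); first mem.
    by apply: (@prov_id _ (Eq (Var v) Zero)); mem.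
  apply: prov_allI.
    have v1' : (1 == v) = false by rewrite eq_sym.
    by apply/allP; rewrite /= vw v1 eqxx /= !in_cons !in_nil v1'.
  apply: (@prov_ex _ w (Eq (Var v) (Succ (Var w))) (Var 1)); [mem|by []|].
  by rewrite /= vw eqxx; apply: (@prov_id _ (Eq (Var v) (Succ (Var 1)))); mem.
have ff : {in [:: Or (Eq (Var v) Zero) (Ex w (Eq (Var v) (Succ (Var w))))],
    forall phi, free_for v (Var y) phi}.
  by move=> f; rewrite mem_seq1 => /eqP -> /=; rewrite mem_seq1 wy orbT.
have /= := prov_subst ff H.
have vw' : (w == v) = false by rewrite eq_sym.
by rewrite vw' eqxx.
Qed.

Lemma prov_case y s :
  prov [seq subst y Zero phi | phi <- s] ->
  prov [seq subst y (Succ (Var y)) phi | phi <- s] -> prov s.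
Proof.
move=> H0 HS.
have [w] := fresh_var (y :: flatten [seq FV phi ++ bv phi | phi <- s]).
rewrite in_cons negb_or => /andP[wy /flattenP ws].
have wF phi : phi \in s -> w \notin FV phi.
  move=> ps; apply/negP => H; apply: ws; exists (FV phi ++ bv phi); last by rewrite mem_cat H.
  exact: map_f.
have wB phi : phi \in s -> w \notin bv phi.
  move=> ps; apply/negP => H; apply: ws; exists (FV phi ++ bv phi); last by rewrite mem_cat H orbT.
  exact: map_f.
apply: (prov_cuts (Q_case wy)) => f; rewrite mem_seq1 => /eqP -> /=.
apply: (prov_and (mem_head _ _)).
  apply: (prov_sub (s := Neq (Var y) Zero :: s)); first submem.
  by apply: prov_eq_subst H0 => phi ps; apply: free_for_self.
apply: (prov_sub (s := All w (Neq (Var y) (Succ (Var w))) :: s)); first submem.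
apply: prov_allI => //; apply: prov_eq_subst.
  by move=> phi ps; apply: free_for_bv => x; rewrite mem_seq1 => /eqP ->; apply: wB.
(* The predecessor of y is called [w], whereas the second hypothesis calls it y; it is an instance
   of that hypothesis under y := w. *)
have -> : [seq subst y (Succ (Var w)) phi | phi <- s] =
    [seq subst y (Var w) phi | phi <- [seq subst y (Succ (Var y)) phi | phi <- s]].
  by rewrite -map_comp; apply: eq_map => phi /=; rewrite subst_subst /= eqxx.
apply: prov_subst HS => psi /mapP[phi ps ->]; apply: free_for_bv => x.
by rewrite mem_seq1 bv_subst => /eqP ->; apply: wB.
Qed.

(** The schema as a rule with side formulas [s], which act as parameters and may be of any
    complexity. *)
Lemma prov_induction x phi s :
  Sigma k phi -> {in s, forall psi, x \notin FV psi} ->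
  prov (subst x Zero phi :: s) ->
  prov (neg phi :: subst x (Succ (Var x)) phi :: s) -> prov (phi :: s).
Proof.
move=> Sphi xs H0 HS.
have H : prov [:: Defs.induction x phi].
  by apply: (@prov_closed _ (undup (FV (Defs.induction x phi)))); apply: ISigma_induction.
apply: (prov_cuts H) => f; rewrite mem_seq1 => /eqP -> /=; rewrite !negK.
apply: (prov_sub (s := And (And (subst x Zero phi)
   (All x (Or (neg phi) (subst x (Succ (Var x)) phi)))) (Ex x (neg phi)) :: phi :: s)).
  submem.
apply: (prov_and (mem_head _ _)).
  apply: (prov_sub (s := And (subst x Zero phi)
      (All x (Or (neg phi) (subst x (Succ (Var x)) phi))) :: s)); first submem.
  apply: (prov_and (mem_head _ _)); first by apply: prov_sub H0; submem.
  apply: (prov_sub (s := All x (Or (neg phi) (subst x (Succ (Var x)) phi)) :: s)); first submem.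
  apply: prov_allI => //; apply: (prov_or (mem_head _ _)).
  by apply: prov_sub HS; submem.
apply: (prov_sub (s := Ex x (neg phi) :: phi :: s)); first submem.
by apply: prov_exI; apply: (@prov_id _ phi); mem.
Qed.

Lemma prov_add0 t s : prov (Eq (Add Zero t) t :: s).
Proof.
apply: prov_weak; have [y _] := fresh_var [::].
have /= := @prov_subst1 _ y t (Eq (Add Zero (Var y)) (Var y)) erefl.
rewrite eqxx; apply.
apply: (@prov_induction y) => [|//||]; first exact: (Sigma_Pi_atomic _ _ _).1.1.
  all: rewrite /= !eqxx.
  exact: Q_add0.
apply: (prov_sub (s := [:: Eq (Add Zero (Succ (Var y))) (Succ (Var y));
  Neq (Add Zero (Var y)) (Var y)])).
  submem.
apply: prov_trans (Q_addS _ _ _) _; apply: prov_eq_Succ; apply: prov_eq_hyp; mem.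
Qed.

Lemma prov_addS t u s : prov (Eq (Add (Succ t) u) (Succ (Add t u)) :: s).
Proof.
apply: prov_weak; have [y yt] := fresh_var (tvars t).
have /= := @prov_subst1 _ y u (Eq (Add (Succ t) (Var y)) (Succ (Add t (Var y)))) erefl.
rewrite eqxx tsubst_notin //; apply.
apply: (@prov_induction y) => [|//||]; first exact: (Sigma_Pi_atomic _ _ _).1.1.
  all: rewrite /= !eqxx !tsubst_notin //.
  apply: prov_trans (Q_add0 _ _) _; apply: prov_sym; apply: prov_eq_Succ; exact: Q_add0.
apply: (prov_sub (s := [:: Eq (Add (Succ t) (Succ (Var y))) (Succ (Add t (Succ (Var y))));
  Neq (Add (Succ t) (Var y)) (Succ (Add t (Var y)))])).
  submem.
apply: prov_trans (Q_addS _ _ _) _; apply: prov_eq_Succ.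
apply: (@prov_trans _ _ (Succ (Add t (Var y)))); first by apply: prov_eq_hyp; mem.
exact: prov_sym (Q_addS _ _ _).
Qed.

(** Needed in [equiv_le], since the order is defined by adding on the left. *)
Lemma prov_addC t u s : prov (Eq (Add t u) (Add u t) :: s).
Proof.
apply: prov_weak; have [y yt] := fresh_var (tvars t).
have /= := @prov_subst1 _ y u (Eq (Add t (Var y)) (Add (Var y) t)) erefl.
rewrite eqxx tsubst_notin //; apply.
apply: (@prov_induction y) => [|//||]; first exact: (Sigma_Pi_atomic _ _ _).1.1.
  all: rewrite /= !eqxx !tsubst_notin //.
  apply: prov_trans (Q_add0 _ _) _; apply: prov_sym; exact: prov_add0.
apply: (prov_sub (s := [:: Eq (Add t (Succ (Var y))) (Add (Succ (Var y)) t);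
  Neq (Add t (Var y)) (Add (Var y) t)])).
  submem.
apply: prov_trans (Q_addS _ _ _) _; apply: prov_trans (prov_sym (prov_addS _ _ _)).
by apply: prov_eq_Succ; apply: prov_eq_hyp; mem.
Qed.

(** The final contradiction of the descent: the sum of [Z] cannot have decreased s(u) times starting
    from u. *)
Lemma prov_add_Succ_neq t u s : prov (Neq (Add t (Succ u)) u :: s).
Proof.
apply: prov_weak; have [y yt] := fresh_var (tvars t).
have /= := @prov_subst1 _ y u (Neq (Add t (Succ (Var y))) (Var y)) erefl.
rewrite eqxx tsubst_notin //; apply.
apply: (@prov_induction y) => [|//||]; first exact: (Sigma_Pi_atomic _ _ _).1.2.
  all: rewrite /= !eqxx !tsubst_notin //.
  apply: prov_neq_context (Q_succ (Add t Zero) _); last exact: prov_eq_refl.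
  exact: prov_sym (Q_addS _ _ _).
apply: Q_inj; apply: prov_trans (prov_sym (Q_addS _ _ _)) _.
by apply: prov_eq_hyp; mem.
Qed.

End Arithmetic.

(** * The arithmetical hierarchy *)

(* [Sigma] and [Pi] are not closed under passing from a quantified formula to
   an instance: an instance of the bounded [Ex y (And (le z y u) f)] contains
   [le z t u], whose quantifier is not syntactically bounded. The classes are
   therefore rebuilt over [Delta0] enlarged with the formulas [le z t u]. *)
Inductive wDelta0 : form -> Prop :=
| wDelta0_eq t u : wDelta0 (Eq t u)
| wDelta0_neq t u : wDelta0 (Neq t u)
| wDelta0_and f g : wDelta0 f -> wDelta0 g -> wDelta0 (And f g)
| wDelta0_or f g : wDelta0 f -> wDelta0 g -> wDelta0 (Or f g)
| wDelta0_le z t u : z \notin tvars t -> z \notin tvars u -> wDelta0 (le z t u)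
| wDelta0_ball z y t f :
    z != y -> z \notin tvars t -> y \notin tvars t -> wDelta0 f ->
    wDelta0 (All y (imp (le z (Var y) t) f))
| wDelta0_bex z y t f :
    z != y -> z \notin tvars t -> y \notin tvars t -> wDelta0 f ->
    wDelta0 (Ex y (And (le z (Var y) t) f)).

Fixpoint wSigma (k : nat) : form -> Prop :=
  if k is m.+1 then ex_closure (wPi m) else wDelta0
with wPi (k : nat) : form -> Prop :=
  if k is m.+1 then all_closure (wSigma m) else wDelta0.

Lemma Sigma_Pi_weak k phi :
  (Sigma k phi -> wSigma k phi) /\ (Pi k phi -> wPi k phi).
Proof.
elim: k phi => [|k IH] phi /=.
  suff H : Delta0 phi -> wDelta0 phi by [].
  by elim=> *; constructor.
split.
  elim=> [f /(proj2 (IH _)) ?|f g _ ? _ ?|f g _ ? _ ?|y f _ ?].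
  - exact: exc_base.
  - exact: exc_and.
  - exact: exc_or.
  - exact: exc_ex.
elim=> [f /(proj1 (IH _)) ?|f g _ ? _ ?|f g _ ? _ ?|y f _ ?].
- exact: allc_base.
- exact: allc_and.
- exact: allc_or.
- exact: allc_all.
Qed.

Lemma Sigma_Pi_neg k phi :
  (Sigma k phi -> Pi k (neg phi)) /\ (Pi k phi -> Sigma k (neg phi)).
Proof.
elim: k phi => [|k IH] phi /=.
  suff H : Delta0 phi -> Delta0 (neg phi) by [].
  by elim=> *; constructor.
split.
  elim=> [f /(proj2 (IH _)) ?|f g _ ? _ ?|f g _ ? _ ?|y f _ ?].
  - exact: allc_base.
  - exact: allc_or.
  - exact: allc_and.
  - exact: allc_all.
elim=> [f /(proj1 (IH _)) ?|f g _ ? _ ?|f g _ ? _ ?|y f _ ?].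
- exact: exc_base.
- exact: exc_or.
- exact: exc_and.
- exact: exc_ex.
Qed.

Lemma le_subst y t z v u :
  z != y -> subst y t (le z v u) = le z (tsubst y t v) (tsubst y t u).
Proof. by rewrite /le /= => /negbTE ->. Qed.

(** If z is y itself, the quantifier shadows y and u does not contain it, so both sides are
    unchanged. *)
Lemma bound_subst y t z x u : x != y -> z \notin tvars u ->
  subst y t (le z (Var x) u) = le z (Var x) (tsubst y t u).
Proof.
move=> xy zu; have [zy|zy] := eqVneq z y; last by rewrite le_subst //= (negbTE xy).
by rewrite /le /= zy eqxx tsubst_notin // -zy.
Qed.

Lemma bound_notin y t z x u :
  free_for y t (le z (Var x) u) -> z \notin tvars u -> z \notin tvars (tsubst y t u).
Proof.
move=> ff zu; have [yu|yu] := boolP (y \in tvars u); last by rewrite tsubst_notin.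
have yz : y != z by apply: contraNneq zu => <-.
move: ff; rewrite free_for_Ex; last by rewrite mem_FV_Ex yz /= in_cons in_cons yu !orbT.
rewrite andbT => zt.
by apply/negP => /tvars_tsubst/orP[|/andP[_]]; apply/negP.
Qed.

Lemma wDelta0_subst y t phi :
  free_for y t phi -> wDelta0 phi -> wDelta0 (subst y t phi).
Proof.
move=> ff H; elim: H ff => {phi}.
- by move=> *; constructor.
- by move=> *; constructor.
- by move=> f g _ IHf _ IHg /= /andP[/IHf ? /IHg ?]; constructor.
- by move=> f g _ IHf _ IHg /= /andP[/IHf ? /IHg ?]; constructor.
- move=> z v u zv zu ff; have [yF|yF] := boolP (y \in FV (le z v u)); last first.
    by rewrite subst_notin //; constructor.
  have zy : z != y by move: yF; rewrite mem_FV_Ex eq_sym => /andP[].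
  rewrite le_subst //; move: ff; rewrite free_for_Ex // andbT => zt.
  by constructor; apply/negP => /tvars_tsubst/orP[|/andP[_]]; apply/negP.
- move=> z x u f zx zu xu Hf IH ff.
  have [yF|yF] := boolP (y \in FV (All x (imp (le z (Var x) u) f))); last first.
    by rewrite subst_notin //; constructor.
  have xy : x != y by move: yF; rewrite ?mem_FV_Ex ?mem_FV_All eq_sym => /andP[].
  have [xt /andP[f1 f2]] : x \notin tvars t /\ free_for y t (imp (le z (Var x) u) f).
    by move: ff; rewrite free_for_All // => /andP.
  have {}f1 : free_for y t (le z (Var x) u) by rewrite -free_for_neg.
  have -> : subst y t (All x (imp (le z (Var x) u) f)) =
      All x (imp (le z (Var x) (tsubst y t u)) (subst y t f)).
    by rewrite -(bound_subst t xy zu) /imp -neg_subst /= (negbTE xy).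
  constructor => //; [exact: bound_notin f1 _| |exact: IH].
  by apply/negP => /tvars_tsubst/orP[|/andP[_]]; apply/negP.
- move=> z x u f zx zu xu Hf IH ff.
  have [yF|yF] := boolP (y \in FV (Ex x (And (le z (Var x) u) f))); last first.
    by rewrite subst_notin //; constructor.
  have xy : x != y by move: yF; rewrite ?mem_FV_Ex ?mem_FV_All eq_sym => /andP[].
  have [xt /andP[f1 f2]] : x \notin tvars t /\ free_for y t (And (le z (Var x) u) f).
    by move: ff; rewrite free_for_Ex // => /andP.
  have -> : subst y t (Ex x (And (le z (Var x) u) f)) =
      Ex x (And (le z (Var x) (tsubst y t u)) (subst y t f)).
    by rewrite -(bound_subst t xy zu) /= (negbTE xy).
  constructor => //; [exact: bound_notin f1 _| |exact: IH].
  by apply/negP => /tvars_tsubst/orP[|/andP[_]]; apply/negP.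
Qed.

Lemma ex_closure_subst C y t :
  (forall phi, free_for y t phi -> C phi -> C (subst y t phi)) ->
  forall phi, free_for y t phi -> ex_closure C phi -> ex_closure C (subst y t phi).
Proof.
move=> HC phi ff H; elim: H ff => {phi}.
- by move=> f Cf ff; apply: exc_base; apply: HC.
- by move=> f g _ IHf _ IHg /= /andP[/IHf ? /IHg ?]; apply: exc_and.
- by move=> f g _ IHf _ IHg /= /andP[/IHf ? /IHg ?]; apply: exc_or.
move=> x f Hf IH ff; have [yF|yF] := boolP (y \in FV (Ex x f)); last first.
  by rewrite subst_notin //; apply: exc_ex.
move: ff; rewrite free_for_Ex // => /andP[_ /IH H].
by rewrite /=; case: ifP => _; apply: exc_ex.
Qed.

Lemma all_closure_subst C y t :
  (forall phi, free_for y t phi -> C phi -> C (subst y t phi)) ->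
  forall phi, free_for y t phi -> all_closure C phi -> all_closure C (subst y t phi).
Proof.
move=> HC phi ff H; elim: H ff => {phi}.
- by move=> f Cf ff; apply: allc_base; apply: HC.
- by move=> f g _ IHf _ IHg /= /andP[/IHf ? /IHg ?]; apply: allc_and.
- by move=> f g _ IHf _ IHg /= /andP[/IHf ? /IHg ?]; apply: allc_or.
move=> x f Hf IH ff; have [yF|yF] := boolP (y \in FV (All x f)); last first.
  by rewrite subst_notin //; apply: allc_all.
move: ff; rewrite free_for_All // => /andP[_ /IH H].
by rewrite /=; case: ifP => _; apply: allc_all.
Qed.

Lemma wSigma_wPi_subst k y t phi : free_for y t phi ->
  (wSigma k phi -> wSigma k (subst y t phi)) /\ (wPi k phi -> wPi k (subst y t phi)).
Proof.
elim: k phi => [|k IH] phi ff /=; first by split; apply: wDelta0_subst.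
split; [apply: ex_closure_subst|apply: all_closure_subst] => // f; by case/IH.
Qed.

Lemma wSigma_wPi_or k f g :
  (wSigma k (Or f g) -> wSigma k f /\ wSigma k g) /\ (wPi k (Or f g) -> wPi k f /\ wPi k g).
Proof.
elim: k => [|k [IH1 IH2]] /=; first by split=> H; inversion H.
split=> H; inversion H => //; subst.
  by case: (IH2 H0) => ? ?; split; apply: exc_base.
by case: (IH1 H0) => ? ?; split; apply: allc_base.
Qed.

Lemma wDelta0_ex y t phi :
  free_for y t phi -> wDelta0 (Ex y phi) -> wDelta0 (subst y t phi).
Proof.
move=> ff H; inversion H; subst; first by constructor.
move: ff => /andP[f1 f2].
have -> : subst y t (And (le z (Var y) t0) f) = And (le z t t0) (subst y t f).
  by rewrite -[LHS]/(And (subst y t (le z (Var y) t0)) _) le_subst //= eqxx tsubst_notin.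
constructor; last exact: wDelta0_subst.
have zy : z != y by [].
have yF : y \in FV (le z (Var y) t0).
  by rewrite mem_FV_Ex eq_sym zy !in_cons eqxx orbT.
have {}f1 : free_for y t (le z (Var y) t0) by [].
by constructor => //; move: f1; rewrite free_for_Ex // andbT.
Qed.

Lemma wSigma_wPi_ex k y t phi : free_for y t phi ->
  (wSigma k (Ex y phi) -> wSigma k (subst y t phi)) /\ (wPi k (Ex y phi) -> wPi k (subst y t phi)).
Proof.
move=> ff; elim: k => [|k [IH1 IH2]] /=; first by split; apply: wDelta0_ex.
split=> H; inversion H; subst.
- by apply: exc_base; apply: IH2.
- by apply: (proj1 (wSigma_wPi_subst k.+1 ff)).
- by apply: allc_base; apply: IH1.
Qed.

Section Equivalence.

Variable k : nat.
Notation prov := (prov (ISigma k)).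

Definition equiv (f g : form) : Prop := prov [:: neg f; g] /\ prov [:: neg g; f].

Lemma equiv_refl f : equiv f f.
Proof. by split; apply: (@prov_id _ f); mem. Qed.

Lemma prov_and_mono f f' g g' :
  prov [:: neg f; f'] -> prov [:: neg g; g'] -> prov [:: neg (And f g); And f' g'].
Proof.
move=> Hf Hg; apply: (@prov_or _ (neg f) (neg g)); first mem.
apply: (@prov_and _ f' g'); first mem.
  by apply: prov_sub Hf; submem.
by apply: prov_sub Hg; submem.
Qed.

Lemma prov_or_mono f f' g g' :
  prov [:: neg f; f'] -> prov [:: neg g; g'] -> prov [:: neg (Or f g); Or f' g'].
Proof.
move=> Hf Hg; apply: (@prov_or _ f' g'); first mem.
apply: (@prov_and _ (neg f) (neg g)); first mem.
  by apply: prov_sub Hf; submem.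
by apply: prov_sub Hg; submem.
Qed.

Lemma prov_all_mono y f f' : prov [:: neg f; f'] -> prov [:: neg (All y f); All y f'].
Proof.
move=> Hf; apply: (prov_sub (s := [:: All y f'; Ex y (neg f)])); first submem.
apply: prov_allI; first by apply/allP; rewrite /= mem_filter eqxx.
apply: (prov_sub (s := [:: Ex y (neg f); f'])); first submem.
exact: prov_exI.
Qed.

Lemma prov_ex_mono y f f' : prov [:: neg f; f'] -> prov [:: neg (Ex y f); Ex y f'].
Proof.
move=> Hf /=; apply: prov_allI; first by apply/allP; rewrite /= mem_filter eqxx.
apply: (prov_sub (s := [:: Ex y f'; neg f])); first submem.
apply: prov_exI; apply: prov_sub Hf; submem.
Qed.

Lemma equiv_and f f' g g' : equiv f f' -> equiv g g' -> equiv (And f g) (And f' g').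
Proof. by move=> [? ?] [? ?]; split; apply: prov_and_mono. Qed.

Lemma equiv_or f f' g g' : equiv f f' -> equiv g g' -> equiv (Or f g) (Or f' g').
Proof. by move=> [? ?] [? ?]; split; apply: prov_or_mono. Qed.

Lemma equiv_all y f f' : equiv f f' -> equiv (All y f) (All y f').
Proof. by move=> [? ?]; split; apply: prov_all_mono. Qed.

Lemma equiv_ex y f f' : equiv f f' -> equiv (Ex y f) (Ex y f').
Proof. by move=> [? ?]; split; apply: prov_ex_mono. Qed.

(** The witness z of z + t = u is itself bounded by u, because t + z = u. Adding this bound makes
    the quantifier syntactically bounded. *)
Lemma equiv_le z t u : z \notin tvars t -> z \notin tvars u ->
  exists2 f, Delta0 f & equiv (le z t u) f.
Proof.
move=> zt zu; have [w] := fresh_var (z :: tvars u).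
rewrite in_cons negb_or => /andP[wz wu].
exists (Ex z (And (le w (Var z) u) (Eq (Add (Var z) t) u))).
  by constructor => //; constructor.
split.
  apply: prov_ex_mono.
  apply: (@prov_and _ (le w (Var z) u) (Eq (Add (Var z) t) u)); first mem.
    rewrite /le; apply: (@prov_ex _ w (Eq (Add (Var w) (Var z)) u) t); [mem|by []|].
    rewrite [subst _ _ _]/= eqxx eq_sym (negbTE wz) tsubst_notin //.
    apply: prov_trans (prov_addC _ _ _ _) _; apply: prov_eq_hyp; mem.
  by apply: (@prov_id _ (Eq (Add (Var z) t) u)); mem.
apply: prov_ex_mono.
apply: (@prov_or _ (neg (le w (Var z) u)) (Neq (Add (Var z) t) u)); first mem.
by apply: (@prov_id _ (Eq (Add (Var z) t) u)); mem.
Qed.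

Lemma wDelta0_equiv f : wDelta0 f -> exists2 f', Delta0 f' & equiv f f'.
Proof.
elim=> {f} [t u|t u|f g _ [f' ? ?] _ [g' ? ?]|f g _ [f' ? ?] _ [g' ? ?]|z t u|
  z y t f ? ? ? _ [f' ? ?]|z y t f ? ? ? _ [f' ? ?]].
- by exists (Eq t u); [constructor|apply: equiv_refl].
- by exists (Neq t u); [constructor|apply: equiv_refl].
- by exists (And f' g'); [constructor|apply: equiv_and].
- by exists (Or f' g'); [constructor|apply: equiv_or].
- exact: equiv_le.
- exists (All y (imp (le z (Var y) t) f')); first by constructor.
  by apply: equiv_all; apply: equiv_or => //; apply: equiv_refl.
- exists (Ex y (And (le z (Var y) t) f')); first by constructor.
  by apply: equiv_ex; apply: equiv_and => //; apply: equiv_refl.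
Qed.

Lemma wSigma_wPi_equiv m f :
  (wSigma m f -> exists2 f', Sigma m f' & equiv f f') /\
  (wPi m f -> exists2 f', Pi m f' & equiv f f').
Proof.
elim: m f => [|m IH] f /=; first by split; apply: wDelta0_equiv.
split; elim=> {f} [f Hf|f g _ [f' ? ?] _ [g' ? ?]|f g _ [f' ? ?] _ [g' ? ?]|y f _ [f' ? ?]].
- by have [f' ? ?] := (IH f).2 Hf; exists f'; first exact: exc_base.
- by exists (And f' g'); [apply: exc_and|apply: equiv_and].
- by exists (Or f' g'); [apply: exc_or|apply: equiv_or].
- by exists (Ex y f'); [apply: exc_ex|apply: equiv_ex].
- by have [f' ? ?] := (IH f).1 Hf; exists f'; first exact: allc_base.
- by exists (And f' g'); [apply: allc_and|apply: equiv_and].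
- by exists (Or f' g'); [apply: allc_or|apply: equiv_or].
- by exists (All y f'); [apply: allc_all|apply: equiv_all].
Qed.

End Equivalence.

(** * Soundness of the rules of SQ *)

Lemma mem_ssubst y t G psi :
  (psi \in ssubst y t G) = (psi \in [seq subst y t phi | phi <- G]).
Proof. exact: (perm_mem (perm_eq_seq_mset _)). Qed.

Section Soundness.

Variable k : nat.
Notation prov := (prov (ISigma k)).

Lemma prov_eqi s s' : s =i s' -> prov s -> prov s'.
Proof. by move=> e; apply: prov_sub => x; rewrite e. Qed.

Lemma prov_enum1 G phi D :
  prov (enum_mset (G `+` [mset phi]) ++ D) <-> prov (phi :: enum_mset G ++ D).
Proof.
have e : enum_mset (G `+` [mset phi]) ++ D =i phi :: enum_mset G ++ D.
  by move=> x; rewrite in_cons !mem_cat in_msetD in_mset1 -orbA orbCA.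
by split; apply: prov_eqi.
Qed.

Lemma prov_enum2 G phi psi D :
  prov (enum_mset (G `+` [mset phi; psi]) ++ D) <->
  prov (phi :: psi :: enum_mset G ++ D).
Proof.
have e : enum_mset (G `+` [mset phi; psi]) ++ D =i phi :: psi :: enum_mset G ++ D.
  move=> x; rewrite !in_cons !mem_cat !in_msetD !in_mset1 -[x \in enum_mset G]/(x \in G).
  by case: (x \in G); case: (x == phi); case: (x == psi); rewrite ?orbT.
by split; apply: prov_eqi.
Qed.

Lemma prov_enum3 G phi psi chi D :
  prov (enum_mset (G `+` [mset phi; psi; chi]) ++ D) <->
  prov (phi :: psi :: chi :: enum_mset G ++ D).
Proof.
have e : enum_mset (G `+` [mset phi; psi; chi]) ++ D =i
    phi :: psi :: chi :: enum_mset G ++ D.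
  move=> x; rewrite !in_cons !mem_cat !in_msetD !in_mset1 -[x \in enum_mset G]/(x \in G).
  by case: (x \in G); case: (x == phi); case: (x == psi); case: (x == chi); rewrite ?orbT.
by split; apply: prov_eqi.
Qed.

Lemma initial_sound G : initial G -> prov (enum_mset G).
Proof.
move=> H; rewrite -[enum_mset G]cats0; case: H => [{}G t0 t1|{}G t].
  apply/prov_enum2; apply: (@prov_id _ (Eq t0 t1)); mem.
by apply/prov_enum1; apply: Q_succ.
Qed.

(** The context [D] carries the assumptions of the descent through the rules. (case) is excluded
    because it would also substitute in [D]; [case_sound] treats it. *)
Lemma rule_sound r D :
  side_condition r ->
  (forall G y, r <> CaseR G y) ->
  (forall G y phi z, r = AllR G y phi z -> {in D, forall psi, z \notin FV psi}) ->
  (forall i G, onth (prems r) i = Some G -> prov (enum_mset G ++ D)) ->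
  prov (enum_mset (concl r) ++ D).
Proof.
have refute phi s : prov (neg phi :: s) -> prov (phi :: s) -> prov s.
  by move=> H1 H2; apply: prov_cut H2 H1.
case: r => [G f g|G f g|G y f z|G y f t|G t|G t0 t1 y u0 u1|G t|G t u|G t|G t u|
            G t0 t1|G y|G E|G f] /= sc nocase fresh H.
- have /prov_enum1 H1 := H 0 _ erefl; have /prov_enum1 H2 := H 1 _ erefl.
  apply/prov_enum1; apply: (prov_and (mem_head _ _)).
    by apply: prov_sub H1; submem.
  by apply: prov_sub H2; submem.
- have /prov_enum2 H1 := H 0 _ erefl.
  apply/prov_enum1; apply: (prov_or (mem_head _ _)).
  by apply: prov_sub H1; submem.
- have /prov_enum1 H1 := H 0 _ erefl; case: sc => ff nz.
  apply/prov_enum1; apply: (prov_all (mem_head _ _) ff) => [psi|].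
    rewrite in_cons => /orP[/eqP ->|].
      by apply/negP => zf; apply: nz; exists (All y f); rewrite // in_msetD in_mset1 eqxx orbT.
    rewrite mem_cat => /orP[pG|pD]; last exact: fresh erefl psi pD.
    by apply/negP => zf; apply: nz; exists psi; rewrite // in_msetD pG.
  by apply: prov_sub H1; submem.
- have /prov_enum2 H1 := H 0 _ erefl.
  apply/prov_enum1; apply: (prov_ex (mem_head _ _) sc).
  exact: H1.
- have /prov_enum1 H1 := H 0 _ erefl; apply: (@refute (Eq t t)) => //; exact: prov_eq_refl.
- have /prov_enum3 H1 := H 0 _ erefl; apply/prov_enum2.
  apply: (@refute (Eq (tsubst y t1 u0) (tsubst y t1 u1))).
    by apply: prov_sub H1; submem.
  apply: (@prov_repl _ y t0 t1 (Eq u0 u1)) => /=; [by []|by []|mem|mem|mem].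
- by have /prov_enum1 H1 := H 0 _ erefl; exact: (@refute (Eq _ _) _ H1 (Q_add0 _ _ _)).
- by have /prov_enum1 H1 := H 0 _ erefl; exact: (@refute (Eq _ _) _ H1 (Q_addS _ _ _ _)).
- by have /prov_enum1 H1 := H 0 _ erefl; exact: (@refute (Eq _ _) _ H1 (Q_mul0 _ _ _)).
- by have /prov_enum1 H1 := H 0 _ erefl; exact: (@refute (Eq _ _) _ H1 (Q_mulS _ _ _ _)).
- have /prov_enum2 H1 := H 0 _ erefl; apply/prov_enum1.
  apply: (@refute (Eq t0 t1)); first by apply: prov_sub H1; submem.
  by apply: Q_inj; apply: prov_eq_hyp; mem.
- by case: (nocase G y).
- have H1 := H 0 _ erefl; apply: prov_sub H1 => x.
  by rewrite !mem_cat in_msetD => /orP[|] ->; rewrite ?orbT.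
- have /prov_enum1 H1 := H 0 _ erefl; have /prov_enum1 H2 := H 1 _ erefl.
  exact: prov_cut H1 H2.
Qed.

Lemma case_sound G y D :
  prov (enum_mset (ssubst y Zero G) ++ [seq subst y Zero phi | phi <- D]) ->
  prov (enum_mset (ssubst y (Succ (Var y)) G) ++ [seq subst y (Succ (Var y)) phi | phi <- D]) ->
  prov (enum_mset G ++ D).
Proof.
have e t : enum_mset (ssubst y t G) ++ [seq subst y t phi | phi <- D] =i
    [seq subst y t phi | phi <- enum_mset G ++ D].
  by move=> x; rewrite map_cat !mem_cat mem_ssubst.
by move=> H0 HS; apply: (@prov_case _ y); [apply: prov_eqi H0|apply: prov_eqi HS].
Qed.

Lemma rule_sound_nil r :
  side_condition r ->
  (forall i G, onth (prems r) i = Some G -> derivable (ISigma k) G) ->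
  derivable (ISigma k) (concl r).
Proof.
move=> sc H; apply/prov_enum; rewrite -[enum_mset _]cats0.
have {}H i G : onth (prems r) i = Some G -> prov (enum_mset G ++ [::]).
  by rewrite cats0 => /H/prov_enum.
have [[G [y e]]|nc] := pselect (exists G y, r = CaseR G y); last first.
  by apply: rule_sound => // G y e; apply: nc; exists G, y.
by rewrite e in H *; apply: (@case_sound _ y); [apply: (H 0)|apply: (H 1)].
Qed.

End Soundness.

(** * Strongly connected components *)

(** Terms do not count, so substitution preserves the size. *)
Fixpoint fsize (phi : form) : nat :=
  match phi with
  | Eq _ _ | Neq _ _ => 0
  | And f g | Or f g => (fsize f + fsize g).+1
  | All _ f | Ex _ f => (fsize f).+1
  end.

Lemma fsize_subst y t phi : fsize (subst y t phi) = fsize phi.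
Proof.
by elim: phi => //= [f -> g ->|f -> g ->|x f IH|x f IH] //; case: ifP; rewrite //= IH.
Qed.

Definition eigen (r : inference) : seq var :=
  if r is AllR _ _ _ z then [:: z] else [::].

Definition sum_vars (Z : seq var) : term := foldr (fun z => Add (Var z)) Zero Z.

Lemma tvars_sum_vars Z : tvars (sum_vars Z) = Z.
Proof. by elim: Z => //= z Z ->. Qed.

(** As z occurs exactly once in [Z], replacing it by s(z) raises the sum by exactly one. *)
Lemma sum_vars_Succ k z Z s : uniq Z -> z \in Z ->
  prov (ISigma k) (Eq (tsubst z (Succ (Var z)) (sum_vars Z)) (Succ (sum_vars Z)) :: s).
Proof.
elim: Z => //= y Z IH /andP[yZ uZ]; rewrite in_cons eq_sym.
case: (eqVneq y z) yZ => [->|yz] /= yZ zZ.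
  by rewrite tsubst_notin ?tvars_sum_vars //; apply: prov_addS.
apply: prov_trans (prov_eq_Add (prov_eq_refl _ _ _) (IH uZ zZ)) _.
exact: Q_addS.
Qed.

Lemma in_add1 (G : sequent) (A f : form) : A \in G `+` [mset f] -> A \in G \/ A = f.
Proof. by rewrite in_msetD in_mset1 => /orP[|/eqP]; [left|right]. Qed.

Lemma in_add2 (G : sequent) (A f g : form) :
  A \in G `+` [mset f; g] -> [\/ A \in G, A = f | A = g].
Proof.
by rewrite !in_msetD !in_mset1 => /or3P[|/eqP|/eqP]; [constructor 1|constructor 2|constructor 3].
Qed.

Lemma in_add3 (G : sequent) (A f g h : form) :
  A \in G `+` [mset f; g; h] -> [\/ A \in G, A = f, A = g | A = h].
Proof.
rewrite !in_msetD !in_mset1 => /orP[|/orP[/orP[/eqP|/eqP]|/eqP]].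
- by constructor 1.
- by constructor 2.
- by constructor 3.
- by constructor 4.
Qed.

Lemma mem_add1 (G : sequent) (f : form) : f \in G `+` [mset f].
Proof. by rewrite in_msetD in_mset1 eqxx orbT. Qed.

(* A strongly connected set [C] of nodes of a cyclic proof, all of whose exits
   are derivable; [nx v i] is the [i]-th child of the node [v], and [Z] consists
   of the active variables of the (case) rules inside [C]. *)
Section Component.

Variables (n : nat) (N : eqType) (C : seq N).
Variables (Gam : N -> sequent) (r : N -> inference) (nx : N -> nat -> N) (Z : seq var).

Let m := n.+1.
Notation T := (ISigma m).
Notation prov := (prov T).

Definition live v i :=
  [/\ v \in C, nx v i \in C & onth (prems (r v)) i = Some (Gam (nx v i))].

Hypothesis uniq_Z : uniq Z.
Hypothesis rule_ok : forall v, v \in C -> side_condition (r v) /\ concl (r v) = Gam v.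
Hypothesis exits : forall v i G, v \in C -> onth (prems (r v)) i = Some G ->
  derivable T G \/ live v i.
Hypothesis case_right : forall v G y, r v = CaseR G y -> ~ live v 0.
Hypothesis case_Z : forall v G z, live v 1 -> r v = CaseR G z -> z \in Z.
Hypothesis eigen_Z : forall v G y phi z, v \in C -> r v = AllR G y phi z -> z \notin Z.
Hypothesis and_Pi : forall v i G f g, live v i -> r v = AndR G f g ->
  (i = 0 -> Pi m f) /\ (i = 1 -> Pi m g).
Hypothesis all_Pi : forall v i G y f z, live v i -> r v = AllR G y f z ->
  Pi m (subst y (Var z) f).
Hypothesis cut_Pi : forall v i G f, live v i -> r v = CutR G f ->
  (i = 0 -> Pi m f) /\ (i = 1 -> Pi m (neg f)).
Hypothesis case_Pi : forall v G z phi, live v 1 -> r v = CaseR G z ->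
  phi \in G -> z \in FV phi -> Pi m phi.
(** One sequent for each z is enough, since it is applied to formulas lying in all sequents of
    [C]. *)
Hypothesis Z_Pi : forall z, z \in Z ->
  exists2 v, v \in C & forall phi, phi \in Gam v -> z \in FV phi -> Pi m phi.
(** The trace of condition (c): no infinite walk in [C] avoids (case). *)
Hypothesis progress : forall (st : nat -> N) (c : nat -> nat),
  (forall t, live (st t) (c t) /\ st t.+1 = nx (st t) (c t)) ->
  exists t G y, r (st t) = CaseR G y.
(** Strong connectedness as an induction principle: what holds at one node and passes from child to
    parent holds on all of [C]. *)
Hypothesis connected : forall (P : N -> Prop) v, v \in C -> P v ->
  (forall w i, live w i -> P (nx w i) -> P w) -> forall w, w \in C -> P w.

Let W phi := wPi m phi.

Lemma W_Pi phi : Pi m phi -> W phi.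
Proof. exact: (proj2 (Sigma_Pi_weak m phi)). Qed.

Lemma W_neq t u : W (Neq t u).
Proof. exact/W_Pi/(Sigma_Pi_atomic _ _ _).2.2. Qed.

(** Restriction leaves few ways for a formula outside [W] to enter a premiss inside [C]: there the
    formulas that (∧), (∀) and (cut) introduce are Π, the equational and arithmetical rules add only
    inequalities, and (case) changes only Π formulas. Otherwise the formula is inherited, or it is a
    disjunct or an instance under (∃), which implies the larger formula; and by closure of [W] that
    one is outside [W] too. *)
Lemma parent v i A : live v i -> A \in Gam (nx v i) -> ~ W A ->
  exists2 B, B \in Gam v &
    ~ W B /\ (B = A \/ fsize A < fsize B /\ prov [:: neg A; B]).
Proof.
move=> Hl; have [vC _ Hp] := Hl; have [sc <-] := rule_ok vC.
have and_W := @and_Pi v i; have all_W := @all_Pi v i; have cut_W := @cut_Pi v i.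
have case_W := @case_Pi v; have case_r := @case_right v; move: Hl and_W all_W cut_W case_W case_r.
move: (nx v i) Hp => w Hp.
have onil j : onth ([::] : seq sequent) j = None by case: j.
have side (G E : sequent) B : B \in G -> ~ W B -> exists2 B', B' \in G `+` E &
    ~ W B' /\ (B' = B \/ fsize B < fsize B' /\ prov [:: neg B; B']).
  by move=> BG nB; exists B; [rewrite in_msetD BG|split; [|left]].
have self (G : sequent) B : B \in G -> ~ W B -> exists2 B', B' \in G &
    ~ W B' /\ (B' = B \/ fsize B < fsize B' /\ prov [:: neg B; B']).
  by move=> BG nB; exists B; [|split; [|left]].
case: (r v) Hp sc => [G f g|G f g|G y f z|G y f t|G t|G t0 t1 y u0 u1|G t|G t u|G t|G t u|
            G t0 t1|G y|G E|G f]; case: i => [|[|i]]; rewrite [onth _ _]/= ?onil;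
  try (match goal with |- None = _ -> _ => let H := fresh in intro H; discriminate H end);
  rewrite [side_condition _]/= [concl _]/= => /Some_inj <- sc Hl and_W all_W cut_W case_W case_r.
- by case/in_add1=> [/side H /H//|-> []]; apply: W_Pi; apply: (and_W _ _ _ Hl erefl).1.
- by case/in_add1=> [/side H /H//|-> []]; apply: W_Pi; apply: (and_W _ _ _ Hl erefl).2.
- case/in_add2=> [/side H /H//|-> nW|-> nW]; exists (Or f g); try exact: mem_add1.
  + split=> [/(proj2 (wSigma_wPi_or _ _ _))[]//|]; right; split; first by rewrite /= ltnS leq_addr.
    by apply: (@prov_or _ f g); [mem|apply: (@prov_id _ f); mem].
  + split=> [/(proj2 (wSigma_wPi_or _ _ _))[]//|]; right; split; first by rewrite /= ltnS leq_addl.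
    by apply: (@prov_or _ f g); [mem|apply: (@prov_id _ g); mem].
- by case/in_add1=> [/side H /H//|-> []]; apply: W_Pi; apply: (all_W _ _ _ _ Hl erefl).
- case/in_add2=> [/side H /H//|-> nW|-> nW]; exists (Ex y f); try exact: mem_add1.
  + split=> [/(proj2 (wSigma_wPi_ex _ sc))//|]; right; split; first by rewrite fsize_subst.
    by apply: (@prov_ex _ y f t); [mem|by []|apply: (@prov_id _ (subst y t f)); mem].
  + by split=> //; left.
- by case/in_add1=> [/self H /H//|-> []]; apply: W_neq.
- by case/in_add3=> [/side H /H//|->|->|->] []; apply: W_neq.
- by case/in_add1=> [/self H /H//|-> []]; apply: W_neq.
- by case/in_add1=> [/self H /H//|-> []]; apply: W_neq.
- by case/in_add1=> [/self H /H//|-> []]; apply: W_neq.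
- by case/in_add1=> [/self H /H//|-> []]; apply: W_neq.
- by case/in_add2=> [/side H /H//|->|->] []; apply: W_neq.
- by case: (case_r _ _ erefl).
- rewrite mem_ssubst => /mapP[B BG ->] nW; exists B => //.
  have [zB|zB] := boolP (y \in FV B); last by rewrite subst_notin // in nW *; split=> //; left.
  case: nW; apply: (proj2 (wSigma_wPi_subst _ _)); first exact: free_for_self.
  exact/W_Pi/(case_W _ _ _ Hl erefl BG zB).
- exact: side.
- by case/in_add1=> [/self H /H//|-> []]; apply: W_Pi; apply: (cut_W _ _ Hl erefl).1.
- by case/in_add1=> [/self H /H//|-> []]; apply: W_Pi; apply: (cut_W _ _ Hl erefl).2.
Qed.

(* Following [parent] backwards around [C], the size of a formula outside [W]
   can only grow, hence it becomes stationary. *)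
Lemma persistent v A : v \in C -> A \in Gam v -> ~ W A ->
  exists B, [/\ ~ W B, forall w, w \in C -> B \in Gam w & prov [:: neg A; B]].
Proof.
pose M := foldr maxn 0 [seq fsize phi | phi <- flatten [seq enum_mset (Gam w) | w <- C]].
have leM w B : w \in C -> B \in Gam w -> fsize B <= M.
  move=> wC BG; rewrite /M.
  have : B \in flatten [seq enum_mset (Gam u) | u <- C].
    by apply/flattenP; exists (enum_mset (Gam w)) => //; apply: map_f.
  elim: (flatten _) => //= f s IH; rewrite in_cons => /orP[/eqP ->|/IH].
    exact: leq_maxl.
  by move=> H; apply: leq_trans H (leq_maxr _ _).
have [d] := ubnP (M - fsize A); elim: d => // d IH in A v * => lt vC AG nA.
have [allA|] := pselect (forall w, w \in C -> A \in Gam w).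
  by exists A; split=> //; apply: (@prov_id _ A); mem.
move=> notall.
(* [A] is missing somewhere, so by [connected] it disappears along some edge read backwards. There
   its parent is strictly larger, while [M] bounds all sizes. *)
have [w [i [lw Aw nAw]]] : exists w i, [/\ live w i, A \in Gam (nx w i) & A \notin Gam w].
  apply: contrapT => H; apply: notall; apply: (connected vC AG) => w i lw Aw.
  by apply: contrapT => nAw; apply: H; exists w, i; split=> //; apply/negP.
have [B BG [nB [e|[lt' AB]]]] := parent lw Aw nA.
  by rewrite -e BG in nAw.
have [wC _ _] := lw.
have [|B' [nB' allB' BB']] := IH B w _ wC BG nB.
  rewrite ltnS in lt; apply: leq_trans lt.
  by apply: ltn_sub2l => //; apply: leq_trans lt' (leM _ _ wC BG).
exists B'; split=> //; apply: (prov_cuts AB) => f; rewrite !in_cons in_nil orbF => /orP[]/eqP ->.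
  by rewrite negK; apply: (@prov_id _ A); mem.
by apply: prov_sub BB'; submem.
Qed.

(** A formula in [W] need not be syntactically Π, while the induction schema accepts only syntactic
    Σ formulas. So each is replaced by a chosen equivalent. *)
Lemma W_hat : exists hat : form -> form,
  forall phi, W phi -> Pi m (hat phi) /\ equiv m phi (hat phi).
Proof.
have /choice : forall phi, exists f, W phi -> Pi m f /\ equiv m phi f.
  move=> phi; have [H|nH] := pselect (W phi); last by exists phi.
  by have [f] := proj2 (wSigma_wPi_equiv m m phi) H; exists f.
by move=> [hat Hhat]; exists hat.
Qed.

Lemma component_derivable v : v \in C -> derivable T (Gam v).
Proof.
have [hat Hhat] := W_hat.
pose S := [seq phi <- flatten [seq enum_mset (Gam w) | w <- C] |
  `[< ~ W phi /\ forall w, w \in C -> phi \in Gam w >]].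
have S_ok phi : phi \in S -> ~ W phi /\ forall w, w \in C -> phi \in Gam w.
  by rewrite mem_filter => /andP[/asboolP].
have in_S w A : w \in C -> A \in Gam w -> ~ W A -> exists2 B, B \in S & prov [:: neg A; B].
  move=> wC AG nA; have [B [nB allB AB]] := persistent wC AG nA; exists B => //.
  rewrite mem_filter; apply/andP; split; first exact/asboolP.
  by apply/flattenP; exists (enum_mset (Gam w)); [apply: map_f|apply: allB].
pose H w := [seq hat phi | phi <- enum_mset (Gam w) & `[< W phi >]].
have in_H w phi : phi \in Gam w -> W phi -> hat phi \in H w.
  by move=> pG Wp; apply: map_f; rewrite mem_filter; apply/andP; split=> //; apply/asboolP.
have H_ok w psi : psi \in H w -> exists2 phi, phi \in Gam w & W phi /\ psi = hat phi.
  by case/mapP=> phi; rewrite mem_filter => /andP[/asboolP Wp pG] ->; exists phi.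
(* Eigenvariables are bound in [psi] as well, so that [psi] can be a side formula of every (∀) in
   [C]. *)
pose X := Z ++ flatten [seq eigen (r w) | w <- C].
have S_X phi z : phi \in S -> z \in X -> z \notin FV phi.
  (* A formula of [S] lies in every sequent: in one where z occurs only in Π formulas, and in the
     conclusion of each (∀), where the eigenvariable is not free. *)
  move=> /S_ok[nW allp]; rewrite mem_cat => /orP[/Z_Pi[w wC HP]|/flattenP[s /mapP[w wC ->]]].
    by apply/negP => zp; apply/nW/W_Pi/(HP phi) => //; apply: allp.
  have [sc e] := rule_ok wC; have {}allp := allp w wC; rewrite -e in allp.
  case: (r w) sc allp => //= G y f z' [_ nz] pG; rewrite mem_seq1 => /eqP ->.
  by apply/negP => zp; apply: nz; exists phi.
pose FVs (s : seq form) := flatten [seq FV phi | phi <- s].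
have FVsP s x phi : x \notin FVs s -> phi \in s -> x \notin FV phi.
  move=> /flattenP xs ps; apply/negP => xp; apply: xs; exists (FV phi) => //; exact: map_f.
pose used := X ++ FVs (S ++ flatten [seq H w | w <- C]).
(* [a] names the initial sum of [Z], and [x] below counts the decreases. *)
have [a a_fresh] := fresh_var used.
have [x] := fresh_var (a :: used); rewrite in_cons negb_or => /andP[xa x_fresh].
have X_fresh z : z \notin used -> z \notin X by rewrite mem_cat => /norP[].
have Z_fresh z : z \notin used -> z \notin Z by move/X_fresh; rewrite mem_cat => /norP[].
have S_fresh z phi : z \notin used -> phi \in S -> z \notin FV phi.
  by rewrite mem_cat => /norP[_ /FVsP zs] ps; apply: zs; rewrite mem_cat ps.
have H_fresh z w phi : z \notin used -> w \in C -> phi \in H w -> z \notin FV phi.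
  rewrite mem_cat => /norP[_ /FVsP zs] wC pH; apply: zs; rewrite mem_cat; apply/orP; right.
  by apply/flattenP; exists (H w) => //; apply: map_f.
(* [psi u]: for some values of [X] such that [Z] has sum [a - u], some sequent
   of [C] fails up to the formulas of [S]. *)
pose sZ := sum_vars Z.
pose bad := disj [seq neg (disj (H w)) | w <- C].
pose body u := And (Eq (Add sZ u) (Var a)) bad.
pose psi u := foldr Ex (body u) X.
have bad_fresh z : z \notin used -> z \notin FV bad.
  move=> zu; apply/negP => /FV_disj[f /mapP[w wC ->]]; rewrite FV_neg => /FV_disj[g gH].
  exact/negP/(H_fresh z w g).
have sZ_fresh z : z \notin Z -> z \notin tvars sZ by rewrite tvars_sum_vars.
have psi_X z u : z \in X -> z \notin FV (psi u) by rewrite FV_foldr_Ex => ->.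
have psi_subst u : subst x u (psi (Var x)) = psi u.
  rewrite subst_foldr_Ex; last exact: X_fresh.
  by rewrite /= eqxx (eq_sym a) (negbTE xa) (tsubst_notin _ (sZ_fresh _ (Z_fresh _ x_fresh)))
    (subst_notin _ (bad_fresh _ x_fresh)).
have x_psi0 : x \notin FV (psi Zero).
  rewrite FV_foldr_Ex negb_and; apply/orP; right; rewrite /= !(mem_cat, in_cons, in_nil) !negb_or.
  by rewrite sZ_fresh ?Z_fresh // xa bad_fresh.
have Sigma_psi u : Sigma m (psi u).
  have Hb : Sigma m (body u).
    apply: exc_and; first exact: (Sigma_Pi_atomic m _ _).1.1.
    rewrite /bad; elim: C {S_fresh} H_ok => [|w s IH] H_ok' /=.
      exact: (Sigma_Pi_atomic m _ _).1.2.
    apply: exc_or; last exact: IH.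
    apply: (proj2 (Sigma_Pi_neg m _)).
    have : forall f, f \in H w -> Pi m f.
      by move=> f /H_ok'[g _ [Wg ->]]; case: (Hhat g Wg).
    elim: (H w) => [|f t IHt] Ht /=; first exact: (Sigma_Pi_atomic m _ _).2.2.
    apply: allc_or; first by apply: Ht; apply: mem_head.
    by apply: IHt => g gt; apply: Ht; apply: mem_tl.
  by rewrite /psi; elim: (X) => //= z s IH; apply: exc_ex.
(* Read as assumptions: the sum is now a - x, and [psi (Succ (Var x))] fails. *)
pose D0 := [:: Neq (Add sZ (Var x)) (Var a); psi (Succ (Var x))].
(* Otherwise unprovability propagates: exits are derivable, so at each node other than (case) some
   premiss in [C] is unprovable with the same [D0]. This yields a walk contradicting [progress]. *)
have inner w : w \in C -> prov (enum_mset (Gam w) ++ D0).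
  move=> wC; apply: contrapT => notw.
  pose Bad u := u \in C /\ ~ prov (enum_mset (Gam u) ++ D0).
  have weaken G (D : seq form) : derivable T G -> prov (enum_mset G ++ D).
    by move/prov_enum; apply: prov_sub => f; apply: mem_catl.
  (* At (case) the left premiss is derivable. If the right one is inside [C] and false, the current
     values already witness [psi (Succ (Var x))], since the conclusion is read at s(z), where the
     sum is one larger. *)
  have nocase u : Bad u -> forall G z, r u <> CaseR G z.
    move=> [uC nu] G z e; apply: nu.
    have [sc eG] := rule_ok uC; rewrite e /= in sc eG; rewrite -{}eG.
    have H0 : derivable T (ssubst z Zero G).
      have [//|lu] := @exits u 0 (ssubst z Zero G) uC (congr1 (fun q => onth (prems q) 0) e).
      by case: (case_right e lu).
    have [H1|lu] := @exits u 1 (ssubst z (Succ (Var z)) G) uC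
      (congr1 (fun q => onth (prems q) 1) e).
      apply: (@weaken G); apply: (@rule_sound_nil m (CaseR G z)) => // -[|[|j]] //= G'.
      - by case=> <-.
      - by case=> <-.
      - by case: j.
    have zZ := case_Z lu e; have [_ u1C] := lu; rewrite e => /Some_inj e1.
    apply: (@case_sound m G z); first exact: weaken.
    rewrite e1; set v1 := nx u 1 in u1C *.
    have zX : z \in X by rewrite mem_cat zZ.
    have xz : (x == z) = false by apply/negP => /eqP xz; move: (X_fresh _ x_fresh); rewrite xz zX.
    have az : (a == z) = false by apply/negP => /eqP az; move: (X_fresh _ a_fresh); rewrite az zX.
    rewrite /D0 [map _ _]/= xz az (subst_notin _ (psi_X _ _ zX)).
    set sZ' := tsubst _ _ _.
    apply: (prov_sub (s := psi (Succ (Var x)) :: enum_mset (Gam v1) ++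
      [:: Neq (Add sZ' (Var x)) (Var a)])); first submem.
    (* The variables of [X] are their own witnesses. *)
    apply: prov_foldr_Ex; apply: (prov_and (mem_head _ _)).
      apply: prov_trans (Q_addS _ _ _ _) _.
      apply: prov_trans (prov_sym (prov_addS _ _ _ _)) _.
      apply: prov_trans (prov_eq_Add (prov_sym (sum_vars_Succ _ _ uniq_Z zZ)) (prov_eq_refl _ _ _)) _.
      by apply: prov_eq_hyp; rewrite -/sZ -/sZ'; mem.
    apply: (@prov_mem_disj _ (neg (disj (H v1)))); first exact: map_f.
    apply: prov_neg_disj => f /H_ok[g gG [Wg ->]].
    have [_ [_ Hg]] := Hhat g Wg; apply: prov_sub Hg; apply: sub_cons; first mem.
    by apply: sub_cons => //; apply: mem_tl; apply: mem_tl; apply: mem_catl.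
  have next u : exists i, Bad u -> live u i /\ Bad (nx u i).
    have [bu|nbu] := pselect (Bad u); last by exists 0.
    apply: contrapT => noi; have [uC nu] := bu; apply: nu.
    have [sc <-] := rule_ok uC; apply: rule_sound => //; first exact: nocase.
      (* The eigenvariable must not occur in [D0]: it is bound in [psi], outside [Z] by [eigen_Z],
         and distinct from the fresh [x] and [a]. *)
      move=> G y f z e.
      have zX : z \in X.
        rewrite mem_cat; apply/orP; right; apply/flattenP; exists (eigen (r u));
          last by rewrite e mem_head.
        exact: map_f.
      have nz (y' : var) : y' \notin used -> z != y'.
        by move=> /X_fresh; apply: contraNneq => <-.
      apply/allP; rewrite /= psi_X // andbT !(mem_cat, in_cons, in_nil) !negb_or.
      by rewrite sZ_fresh ?nz // (eigen_Z uC e).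
    move=> i G e; have [/weaken//|lu] := exits uC e; have [_ u1C e1] := lu.
    apply: contrapT => nG; apply: noi; exists i => _; split=> //; split=> // Hp; apply: nG.
    by move: e; rewrite e1 => /Some_inj <-.
  have [f Hf] := choice next.
  pose st t := iter t (fun u => nx u (f u)) w.
  have bad_st t : Bad (st t).
    by elim: t => [|t [+ +]]; [split|move=> ? ?; case: (Hf (st t))].
  have [t [G [y e]]] := @progress st (fun t => f (st t))
    (fun t => conj (Hf _ (bad_st t)).1 erefl).
  exact: nocase (bad_st t) G y e.
(* Trading [Gam w] for [S] and [H w] leaves side formulas [S] free of [X], so that [X] can be
   quantified over in the next step. *)
have outer w : w \in C -> prov (S ++ H w ++ D0).
  move=> wC; apply: (prov_cuts (inner w wC)) => f; rewrite mem_cat => /orP[fG|fD]; last first.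
    apply: (@prov_id _ f); last exact: mem_head.
    by apply: mem_tl; do 2 apply: mem_catr.
  have [Wf|nWf] := pselect (W f).
    have [_ [Hf _]] := Hhat f Wf; apply: prov_sub Hf; apply: sub_cons; first mem.
    apply: sub_cons => //; apply: mem_tl; apply: mem_catr; apply: mem_catl; exact: in_H.
  have [B BS Hf] := in_S w f wC fG nWf; apply: prov_sub Hf; submem.
have step : prov (neg (psi (Var x)) :: psi (Succ (Var x)) :: S).
  rewrite neg_foldr_Ex; apply: prov_foldr_All.
    by move=> f; rewrite in_cons => /orP[/eqP -> z|fS z zX]; [apply: psi_X|apply: S_X].
  apply: (@prov_or _ (Neq (Add sZ (Var x)) (Var a)) (neg bad)); first exact: mem_head.
  apply: (prov_sub (s := neg bad :: Neq (Add sZ (Var x)) (Var a) :: psi (Succ (Var x)) :: S)).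
    submem.
  apply: prov_neg_disj => f /mapP[w wC ->]; rewrite negK; apply: prov_disj.
  by apply: prov_sub (outer w wC); rewrite /D0; submem.
have descent : prov (psi (Var x) :: neg (psi Zero) :: S).
  apply: (@prov_induction _ x) => //.
  - move=> f; rewrite in_cons => /orP[/eqP ->|fS]; first by rewrite FV_neg.
    exact: S_fresh fS.
  - by rewrite psi_subst; apply: (@prov_id _ (psi Zero)); mem.
  - by rewrite psi_subst; apply: prov_sub step; submem.
(* After s(a) decreases the body would assert that the sum plus s(a) equals a. *)
have exhausted : prov (neg (psi (Var x)) :: [:: Neq (Var x) (Succ (Var a))]).
  rewrite neg_foldr_Ex; apply: prov_foldr_All.
    move=> f; rewrite mem_seq1 => /eqP -> z zX /=; rewrite !in_cons in_nil orbF negb_or.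
    by apply/andP; split; apply: contraTneq zX => ->; apply: X_fresh.
  apply: (@prov_or _ (Neq (Add sZ (Var x)) (Var a)) (neg bad)); first exact: mem_head.
  apply: prov_neq_context (prov_add_Succ_neq _ sZ (Var a) _); last exact: prov_eq_refl.
  apply: prov_eq_Add; first exact: prov_eq_refl.
  by apply: prov_sym; apply: prov_eq_hyp; mem.
have {step descent exhausted} start : prov (neg (psi Zero) :: S).
  have : prov (Neq (Var x) (Succ (Var a)) :: neg (psi Zero) :: S).
    apply: (@prov_cut _ (psi (Var x))); first by apply: prov_sub descent; submem.
    by apply: prov_sub exhausted; submem.
  have x_S f : f \in neg (psi Zero) :: S -> x \notin FV f.
    rewrite in_cons => /orP[/eqP ->|fS]; first by rewrite FV_neg.
    exact: S_fresh fS.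
  move/(@prov_subst _ x (Succ (Var a))) => /(_ _)/prov_cuts; apply.
    move=> f; rewrite in_cons => /orP[/eqP ->//|/x_S]; exact: free_for_notin.
  move=> f /=; rewrite in_cons => /orP[/eqP ->|].
    by rewrite /= eqxx (eq_sym a) (negbTE xa); apply: prov_eq_refl.
  rewrite -/(map _ (neg (psi Zero) :: S)) => /mapP[g gS ->].
  by rewrite subst_notin ?x_S //; apply: (@prov_id _ g); mem.
move=> vC; apply/prov_enum.
(* The current values witness [psi Zero], provided that [a] is their sum. *)
have top : prov (Neq (Add sZ Zero) (Var a) :: S ++ H v).
  apply: (@prov_cut _ (psi Zero)); last by apply: prov_sub start; submem.
  apply: prov_foldr_Ex; apply: (prov_and (mem_head _ _)).
    by apply: prov_eq_hyp; mem.
  apply: (@prov_mem_disj _ (neg (disj (H v)))); first exact: map_f.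
  by apply: prov_neg_disj => f fH; apply: (@prov_id _ f); mem.
(* [a] is now instantiated by that sum, which makes the remaining equation an instance of
   reflexivity. *)
have {}top : prov (S ++ H v).
  have a_SH f : f \in S ++ H v -> a \notin FV f.
    by rewrite mem_cat => /orP[fS|fH]; [apply: S_fresh fS|apply: H_fresh fH].
  move: top => /(@prov_subst _ a (Add sZ Zero)) => /(_ _)/prov_cuts; apply.
    move=> f; rewrite in_cons => /orP[/eqP ->//|/a_SH]; exact: free_for_notin.
  move=> f; rewrite [map _ _]/= in_cons => /orP[/eqP ->|].
    by rewrite /= eqxx tsubst_notin ?sZ_fresh ?Z_fresh //; apply: prov_eq_refl.
  by move=> /mapP[g gS ->]; rewrite subst_notin ?a_SH //; apply: (@prov_id _ g); mem.
apply: (prov_cuts top) => f; rewrite mem_cat => /orP[/S_ok[_ /(_ _ vC) fG]|/H_ok[g gG [Wg ->]]].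
  by apply: (@prov_id _ f); [apply: mem_tl|apply: mem_head].
have [_ [_ Hg]] := Hhat g Wg; apply: prov_sub Hg; apply: sub_cons; first mem.
by apply: sub_cons => //; apply: mem_tl.
Qed.

End Component.

(** * Premisses determine the two-premiss rules *)

Lemma perm_add1 (G : sequent) (f : form) :
  perm_eq (enum_mset (G `+` [mset f])) (f :: enum_mset G).
Proof.
by apply/eq_seq_msetP; rewrite mset_cons !seq_mset_id msetDC.
Qed.

Definition weight (G : sequent) : nat := sumn [seq fsize f | f <- enum_mset G].

Lemma weight_add1 G f : weight (G `+` [mset f]) = fsize f + weight G.
Proof. by rewrite /weight (perm_sumn (perm_map fsize (perm_add1 G f))). Qed.

Lemma size_add1 (G : sequent) f :
  size (enum_mset (G `+` [mset f])) = (size (enum_mset G)).+1.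
Proof. by rewrite (perm_size (perm_add1 G f)). Qed.

Lemma weight_ssubst y t G : weight (ssubst y t G) = weight G.
Proof.
rewrite /weight (perm_sumn (perm_map fsize (perm_eq_seq_mset _))) -map_comp.
by congr sumn; apply: eq_map => f /=; rewrite fsize_subst.
Qed.

Lemma size_ssubst y t G : size (enum_mset (ssubst y t G)) = size (enum_mset G).
Proof. by rewrite (perm_size (perm_eq_seq_mset _)) size_map. Qed.

Lemma add1_eq (G : sequent) f : (G `+` [mset f]) f = (G f).+1.
Proof. by rewrite msetE2 msetnE eqxx addn1. Qed.

Lemma add1_neq (G : sequent) f g : g <> f -> (G `+` [mset f]) g = G g.
Proof. by rewrite msetE2 msetnE; case: eqP; rewrite ?addn0. Qed.

Lemma add1_ge (G : sequent) f g : G g <= (G `+` [mset f]) g.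
Proof. by rewrite msetE2 leq_addr. Qed.

Lemma add1_inj (G : sequent) f g : G `+` [mset f] = G `+` [mset g] -> f = g.
Proof.
move=> e; apply: contrapT => ne; have := add1_eq G f; rewrite e add1_neq //.
by move=> /eqP; rewrite ltn_eqF.
Qed.

(** If the principal formulas differed, the first premiss on the left would have lost one occurrence
    of φ ∧ ψ, while the one on the right would have kept them all. *)
Lemma and_det G f g G' f' g' :
  G `+` [mset And f g] = G' `+` [mset And f' g'] ->
  G `+` [mset f] = G' `+` [mset f'] -> AndR G f g = AndR G' f' g'.
Proof.
move=> e1 e2; have [e|ne] := pselect (And f g = And f' g').
  by move: e e1 {e2} => [-> ->] /(congr1 (msetB^~ [mset And f' g'])); rewrite !msetDKBC => ->.
have nf : And f g <> f.
  move=> /(congr1 fsize) /= e; have := leq_addr (fsize g) (fsize f).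
  by rewrite -ltnS e ltnn.
have := add1_ge G' f' (And f g).
by rewrite -e2 (add1_neq _ nf) -(add1_neq G' ne) -e1 add1_eq ltnn.
Qed.

(** If y' differed from y, a formula with y free would keep it under y' := 0, whereas no formula
    under y := 0 contains y. *)
Lemma case_det G y y' : in_FVs y G ->
  ssubst y Zero G = ssubst y' Zero G -> y = y'.
Proof.
move=> [f fG yf] e; apply: contrapT => /eqP ne.
have : subst y' Zero f \in ssubst y Zero G by rewrite e mem_ssubst map_f.
rewrite mem_ssubst => /mapP[g gG eg].
by have := FV_subst_Zero y g; rewrite -eg FV_subst_ne.
Qed.

Variant two_prems : inference -> Prop :=
| Two_and G f g : two_prems (AndR G f g)
| Two_case G y : two_prems (CaseR G y)
| Two_cut G f : two_prems (CutR G f).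

Lemma two_premsP r : size (prems r) = 2 -> two_prems r.
Proof. by case: r => //= *; constructor. Qed.

(** The first premiss tells the rules apart: compared with the conclusion, (∧) lowers the weight and
    keeps the number of formulas, (case) keeps both, and (cut) adds a formula. *)
Lemma rule_det r r' : size (prems r) = 2 -> side_condition r ->
  concl r = concl r' -> prems r = prems r' -> r = r'.
Proof.
move=> s2 sc ec ep; have s2' : size (prems r') = 2 by rewrite -ep.
have e0 : nth mset0 (prems r) 0 = nth mset0 (prems r') 0 by rewrite ep.
have H := two_premsP s2; have H' := two_premsP s2'; move: sc ec e0 => {s2 s2' ep}.
case: H => [G f g|G y|G f]; case: H' => [G' f' g'|G' y'|G' f'];
  rewrite [side_condition _]/= [concl _]/= [concl _]/= [nth _ _ _]/= [nth _ _ _]/= => sc ec e0.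
- exact: and_det ec e0.
- move: (congr1 weight e0); rewrite weight_ssubst -ec !weight_add1 => /eqP.
  by rewrite eqn_add2r ltn_eqF //= ltnS leq_addr.
- move: (congr1 (fun H : sequent => size (enum_mset H)) e0) => /eqP.
  by rewrite -ec !size_add1 ltn_eqF.
- move: (congr1 weight e0); rewrite weight_ssubst ec !weight_add1 => /eqP.
  by rewrite eqn_add2r gtn_eqF //= ltnS leq_addr.
- by rewrite ec in sc e0 *; rewrite (case_det sc e0).
- move: (congr1 (fun H : sequent => size (enum_mset H)) e0) => /eqP.
  by rewrite size_ssubst -ec size_add1 ltn_eqF.
- move: (congr1 (fun H : sequent => size (enum_mset H)) e0) => /eqP.
  by rewrite ec !size_add1 gtn_eqF.
- move: (congr1 (fun H : sequent => size (enum_mset H)) e0) => /eqP.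
  by rewrite size_ssubst -ec size_add1 gtn_eqF.
- by rewrite ec in e0 *; rewrite (add1_inj e0).
Qed.

Lemma onth_inj (A : Type) (s s' : seq A) : (forall i, onth s i = onth s' i) -> s = s'.
Proof.
elim: s s' => [|x s IH] [|y s'] // H; try by have := H 0.
by have [->] := H 0; rewrite (IH s') // => i; apply: (H i.+1).
Qed.

(** * Regular proofs as finite graphs *)

Lemma size_prems r : size (prems r) <= 2.
Proof. by case: r. Qed.

Lemma onth_size (A : Type) (s : seq A) i : onth s i <> None -> i < size s.
Proof. by elim: s i => [|x s IH] [|i] //= /IH. Qed.

Section Graph.

Variables (n : nat) (P : ptree) (ps : seq (seq nat)).
Let m := n.+1.
Notation T := (ISigma m).
Hypothesis rules : by_rules P.
Hypothesis reg : forall p, mark P p <> None -> exists2 q, q \in ps & isomorphic_subtrees P p q.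
Hypothesis restricted : Pi_restricted m P.

Let N := seq_sub ps.

(** [ps] may list addresses outside the tree. They get a dummy sequent and are excluded by
    [valid]. *)
Definition Gam (v : N) : sequent := odflt mset0 (mark P (val v)).
Definition valid (v : N) : bool := isSome (mark P (val v)).
Definition edge (v : N) (i : nat) : bool := isSome (mark P (rcons (val v) i)).

Lemma step_ex : exists step : N -> nat -> N, forall v i, edge v i ->
  isomorphic_subtrees P (rcons (val v) i) (val (step v i)).
Proof.
have /choice[f Hf] : forall vi : N * nat, exists w : N, edge vi.1 vi.2 ->
    isomorphic_subtrees P (rcons (val vi.1) vi.2) (val w).
  move=> [v i] /=; case E : (mark P (rcons (val v) i)) => [G|].
    by have [|q qps Hq] := reg (p := rcons (val v) i); [rewrite E|exists (SeqSub qps)].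
  by exists v; rewrite /edge E.
by exists (fun v i => f (v, i)) => v i; apply: (Hf (v, i)).
Qed.

Variable step : N -> nat -> N.
Hypothesis stepP : forall v i, edge v i ->
  isomorphic_subtrees P (rcons (val v) i) (val (step v i)).

(** Rules transferred along an isomorphism of subtrees agree with [v] on sequents only, hence a
    relation rather than the rule stored in [P]. *)
Definition fits (r : inference) (v : N) : Prop :=
  [/\ side_condition r, concl r = Gam v
    & forall i, onth (prems r) i = mark P (rcons (val v) i)].

Lemma validP v : valid v -> mark P (val v) = Some (Gam v).
Proof. by rewrite /valid /Gam; case: (mark P _). Qed.

Lemma edge_mark v i : edge v i -> mark P (rcons (val v) i) = mark P (val (step v i)).
Proof. by move=> /stepP/(_ [::]); rewrite !cats0. Qed.

Lemma edge_valid v i : edge v i -> valid (step v i).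
Proof. by move=> H; rewrite /valid -edge_mark. Qed.

Lemma edge_Gam v i : edge v i -> mark P (rcons (val v) i) = Some (Gam (step v i)).
Proof. by move=> H; rewrite edge_mark // validP // edge_valid. Qed.

Lemma fits_prems r r' v : fits r v -> fits r' v -> prems r = prems r'.
Proof. by move=> [_ _ H] [_ _ H']; apply: onth_inj => i; rewrite H H'. Qed.

Lemma fits_det r r' v : fits r v -> fits r' v -> size (prems r) = 2 -> r = r'.
Proof.
move=> H H' s2; have e := fits_prems H H'; case: H H' => sc ec _ [_ ec' _].
by apply: rule_det => //; rewrite ec ec'.
Qed.

Lemma mark_prefix p s : mark P (p ++ s) <> None -> mark P p <> None.
Proof.
elim/last_ind: s => [|s i IH]; first by rewrite cats0.
rewrite -rcons_cat => H; apply: IH => e; apply: H.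
by have := rules.2 (p ++ s); rewrite e => /(_ i).
Qed.

(** Conditions (a) to (g) re-indexed by the time of a walk; (c) enters as the existence of one
    application of (case). *)
Definition tail_conditions (rr : nat -> inference) (c : nat -> nat) (M : nat) : Prop :=
  [/\ forall t G y, M <= t -> rr t = CaseR G y -> c t <> 0,
      forall t G z j D y f, M <= t -> rr t = CaseR G z -> c t = 1 -> t < j ->
        rr j <> AllR D y f z
    & exists t G y, rr t = CaseR G y] /\
  [/\ forall t G f g, M <= t -> rr t = AndR G f g ->
        (c t = 0 -> Pi m f) /\ (c t = 1 -> Pi m g),
      forall t G y f z, M <= t -> rr t = AllR G y f z -> Pi m (subst y (Var z) f),
      forall t G f, M <= t -> rr t = CutR G f ->
        (c t = 0 -> Pi m f) /\ (c t = 1 -> Pi m (neg f))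
    & forall t G z, M <= t -> rr t = CaseR G z -> c t = 1 ->
        forall f, f \in G -> z \in FV f -> Pi m f].

(* Every infinite walk in the graph is traced by a branch of [P] with the same
   sequents, although possibly not with the same rules. *)
Lemma walk_branch (st : nat -> N) (c : nat -> nat) :
  valid (st 0) -> (forall t, edge (st t) (c t) /\ st t.+1 = step (st t) (c t)) ->
  exists rr M, (forall t, fits (rr t) (st t)) /\ tail_conditions rr c M.
Proof.
move=> v0 walk; set q := val (st 0); set l := size q.
(* The branch first descends to the address of the starting node and then copies the choices of the
   walk. *)
pose b t := if t < l then nth 0 q t else c (t - l).
have bl t : b (l + t) = c t by rewrite /b ltnNge leq_addr /= addKn.
have mk t : mkseq b (l + t) = q ++ mkseq c t.
  rewrite /mkseq iotaD map_cat; congr (_ ++ _).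
    rewrite -[RHS](mkseq_nth 0) /mkseq; apply/eq_in_map => i.
    by rewrite mem_iota /b => /= ->.
  by rewrite add0n -[X in iota X _]addn0 iotaDl -map_comp; apply: eq_map => i /=; rewrite bl.
have iso t : isomorphic_subtrees P (q ++ mkseq c t) (val (st t)).
  elim: t => [|t IH] s; first by rewrite cats0.
  have [e ->] := walk t; rewrite mkseqS -rcons_cat.
  by rewrite -stepP // !cat_rcons IH.
have vt t : valid (st t) by case: t => // t; have [e ->] := walk t; apply: edge_valid.
have mt t : mark P (q ++ mkseq c t) = Some (Gam (st t)).
  by rewrite -[q ++ _]cats0 iso cats0 validP.
(* The default is never taken: the walk has an edge at each time, so the node is not a leaf. *)
pose rr t := odflt (WeakR mset0 mset0) (rule P (q ++ mkseq c t)).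
have rP t : rule P (q ++ mkseq c t) = Some (rr t) /\ fits (rr t) (st t).
  have := rules.2 (q ++ mkseq c t); rewrite mt /rr.
  case: (rule P _) => [r [sc ec H]|[_ /(_ (c t))]] /=.
    by split=> //; split=> // i; rewrite -H -cats1 iso cats1.
  by have [+ _] := walk t; rewrite /edge -[rcons (val _) _]cats1 -iso cats1 => + e; rewrite e.
have rat t : rule_at P b (l + t) = Some (rr t) by rewrite /rule_at mk; case: (rP t).
have ib : infinite_branch P b.
  move=> k; apply: (@mark_prefix _ (map b (iota k l))).
  have -> : mkseq b k ++ map b (iota k l) = mkseq b (l + k).
    by rewrite addnC /mkseq iotaD map_cat.
  by rewrite mk mt.
have [M [[Ha Hb [y Hc]] [Hd He Hf Hg]]] := restricted ib.
exists rr, M; split; first by move=> t; case: (rP t).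
have leM t : M <= t -> M <= l + t by move=> H; apply: leq_trans H (leq_addl _ _).
split; split.
- by move=> t G y' /leM H e; rewrite -bl; apply: (Ha _ G y' H); rewrite rat e.
- move=> t G z j D y' f /leM H e c1 lt e'.
  apply: (Hb _ G z H _ _ (l + j) D y' f); rewrite ?rat ?bl ?e ?e' //.
  by rewrite ltn_add2l.
(* Taking [l] as the bound places the application of (case) beyond the initial descent. *)
- have [k [G [_ lk]]] := Hc l; rewrite -(subnKC lk) rat => -[e] _.
  by exists (k - l), G, y.
- by move=> t G f g /leM H e; rewrite -bl; apply: (Hd _ G _ _ H); rewrite rat e.
- by move=> t G y' f z /leM H e; apply: (He _ G y' f z H); rewrite rat e.
- by move=> t G f /leM H e; rewrite -bl; apply: (Hf _ G _ H); rewrite rat e.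
- move=> t G z /leM H e c1; apply: (Hg _ G z H); by rewrite ?rat ?bl ?e.
Qed.

Definition bad (v : N) : bool := valid v && `[< ~ derivable T (Gam v) >].

Lemma badP v : reflect (valid v /\ ~ derivable T (Gam v)) (bad v).
Proof. by apply: (iffP andP) => -[? /asboolP]. Qed.

Lemma bad_step v : bad v -> exists2 i, edge v i & bad (step v i).
Proof.
move=> /badP[vv nd]; apply: contrapT => H; apply: nd.
have := rules.2 (val v); rewrite validP //.
case: (rule P _) => [r [sc <- Hp]|[/initial_sound I _]]; last exact/prov_enum.
apply: rule_sound_nil => // i G; rewrite -Hp => e.
have ed : edge v i by rewrite /edge e.
move: e; rewrite edge_Gam // => /Some_inj <-; apply: contrapT => nd.
by apply: H; exists i => //; apply/badP; split=> //; apply: edge_valid.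
Qed.

Lemma edge_lt2 v i : valid v -> edge v i -> i < 2.
Proof.
move=> vv; rewrite /edge; have := rules.2 (val v); rewrite validP //.
case: (rule P _) => [r [_ _ ->] H|[_ ->] //].
apply: leq_trans (size_prems r); apply: onth_size; by case: (onth _ _) H.
Qed.

Fixpoint bad_walk (v : N) (s : seq nat) : bool :=
  if s is i :: s' then [&& edge v i, bad (step v i) & bad_walk (step v i) s'] else true.

Lemma bad_walk_cat v s s' :
  bad_walk v (s ++ s') = bad_walk v s && bad_walk (foldl step v s) s'.
Proof. by elim: s v => //= i s IH v; rewrite IH !andbA. Qed.

Definition succ : rel N := fun v w =>
  [&& bad v, bad w & [exists i : 'I_2, edge v i && (step v i == w)]].

Lemma succP v w : succ v w -> exists2 i, edge v i & step v i = w.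
Proof. by case/and3P=> _ _ /existsP[i /andP[ei /eqP]]; exists i. Qed.

Lemma succ_step v i : bad v -> edge v i -> bad (step v i) -> succ v (step v i).
Proof.
move=> bv ei bw; apply/and3P; split=> //; apply/existsP.
have [vv _] := badP _ bv.
by exists (Ordinal (edge_lt2 vv ei)); rewrite ei /=.
Qed.

Lemma connect_bad v w : bad v -> connect succ v w -> bad w.
Proof.
move=> bv /connectP[p Hp ->]; elim: p v bv Hp => //= u p IH v bv /andP[/and3P[_ bu _] Hp].
exact: IH.
Qed.

Lemma connect_walk v w : connect succ v w ->
  exists2 s, bad_walk v s & foldl step v s = w.
Proof.
move=> /connectP[p Hp ->]; elim: p v Hp => [|u p IH] v /=; first by exists [::].
move=> /andP[vu /IH[s Hs <-]]; have [i ei e] := succP vu.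
by exists (i :: s); rewrite /= e // ei; case/and3P: vu => _ ->.
Qed.

(** Choose [w] with the fewest reachable nodes. A node reachable from it reaches no more and, by
    minimality, no fewer, so it reaches [w] again. *)
Lemma minimal_bad v : bad v -> exists2 w, bad w &
  forall u, connect succ w u -> connect succ u w.
Proof.
move=> bv; case: (arg_minnP (fun u => #|connect succ u|) bv) => w bw Hmin.
exists w => // u wu; have bu := connect_bad bw wu.
have sub : connect succ u \subset connect succ w.
  by apply/subsetP => z; apply: connect_trans.
have /subset_leqif_card : connect succ u \subset connect succ w by [].
rewrite /leqif => -[le]; rewrite eqn_leq le Hmin // => /esym/subsetP/(_ w).
by rewrite !inE; apply; apply: connect0.
Qed.

(** The listed edges are appended one at a time, joined by connecting walks, and a last walk returns
    to v. Being closed, the result can be repeated forever. *)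
Lemma covering_walk (C : seq N) v (L : seq (N * nat)) : v \in C ->
  {in C &, forall u w, connect succ u w} ->
  (forall p, p \in L -> [/\ p.1 \in C, edge p.1 p.2, bad (step p.1 p.2) & step p.1 p.2 \in C]) ->
  exists s, [/\ bad_walk v s, foldl step v s = v &
    forall p, p \in L -> exists s1 s2, s = s1 ++ p.2 :: s2 /\ foldl step v s1 = p.1].
Proof.
move=> vC conn HL.
suff [s [Hs sC cov]] : exists s, [/\ bad_walk v s, foldl step v s \in C &
    forall p, p \in L -> exists s1 s2, s = s1 ++ p.2 :: s2 /\ foldl step v s1 = p.1].
  have [s' Hs' e] := connect_walk (conn _ _ sC vC).
  exists (s ++ s'); rewrite bad_walk_cat Hs Hs' foldl_cat e; split=> // p /cov[s1 [s2 [-> <-]]].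
  by exists s1, (s2 ++ s'); rewrite -catA.
elim: L HL => [|p L IH] HL; first by exists [::].
have [|s [Hs sC cov]] := IH; first by move=> q qL; apply: HL; rewrite in_cons qL orbT.
have [pC ep bp spC] := HL p (mem_head _ _).
have [s' Hs' e] := connect_walk (conn _ _ sC pC).
exists (s ++ s' ++ [:: p.2]); rewrite !bad_walk_cat !foldl_cat Hs Hs' e /= ep bp spC; split=> // q.
rewrite in_cons => /orP[/eqP ->|/cov[s1 [s2 [-> <-]]]].
  by exists (s ++ s'), [::]; rewrite -catA foldl_cat e.
by exists s1, (s2 ++ s' ++ [:: p.2]); rewrite -catA.
Qed.

Lemma no_bad v : ~~ bad v.
Proof.
apply/negP => /minimal_bad[v0 bv0 back].
pose C := enum (connect succ v0).
have memC u : (u \in C) = connect succ v0 u by rewrite mem_enum.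
have v0C : v0 \in C by rewrite memC connect0.
have badC u : u \in C -> bad u by rewrite memC; apply: connect_bad.
have stepC u i : u \in C -> edge u i -> bad (step u i) -> step u i \in C.
  move=> uC ei bi; have bu := badC u uC; move: uC; rewrite !memC => uC.
  by apply: connect_trans uC _; apply: connect1; apply: succ_step.
have conn : {in C &, forall u w, connect succ u w}.
  by move=> u w; rewrite !memC => /back uv vw; apply: connect_trans uv vw.
pose inner (p : N * nat) := [/\ p.1 \in C, edge p.1 p.2 & bad (step p.1 p.2)].
pose L := [seq p <- [seq (u, i) | u <- C, i <- iota 0 2] | edge p.1 p.2 && bad (step p.1 p.2)].
have inL u i : inner (u, i) -> (u, i) \in L.
  move=> [/= uC ei bi]; rewrite mem_filter; apply/andP; split; first exact/andP.
  apply/allpairsP; exists (u, i); split=> //.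
  by rewrite mem_iota; apply: edge_lt2 ei; case/badP: (badC u uC).
have [|w [Hw ew cov]] := @covering_walk C v0 L v0C conn.
  move=> [u i]; rewrite mem_filter => /andP[eb /allpairsP[[u' i'] [/= uC _ [eu _]]]].
  case/andP: eb => /= ei bi.
  by rewrite -eu in uC; split=> //; apply: stepC.
have w_gt0 : 0 < size w.
  have [i ei bi] := bad_step bv0; have [|s1 [s2 [-> _]]] := cov (v0, i); first exact: inL.
  by rewrite size_cat addnS.
set l := size w in w_gt0.
(* The covering walk is repeated with period [l]. *)
pose c t := nth 0 w (t %% l); pose st t := foldl step v0 (take (t %% l) w).
have mod_lt t : t %% l < l by rewrite ltn_mod.
have takeS k : k < l -> take k.+1 w = rcons (take k w) (nth 0 w k).
  by move=> kl; rewrite (take_nth 0).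
have w_edge k : k < l -> [/\ edge (foldl step v0 (take k w)) (nth 0 w k)
    & bad (step (foldl step v0 (take k w)) (nth 0 w k))].
  move=> kl; have : bad_walk v0 (take k w ++ drop k w) by rewrite cat_take_drop.
  by rewrite bad_walk_cat (drop_nth 0 kl) /= => /and4P[_ -> ->].
have stS t : st t.+1 = step (st t) (c t).
  rewrite /st /c; have := takeS _ (mod_lt t);
  rewrite -[step _ _]/(foldl step _ [:: _]) -foldl_cat cats1.
  move=> <-; rewrite modnS; case: ifP => // dv.
  rewrite take0 take_oversize //; apply: dvdn_leq => //.
  by move: dv; rewrite {1}(divn_eq t l) -addnS dvdn_addr // dvdn_mull.
have st_C t : st t \in C.
  elim: t => [|t IH]; first by rewrite /st mod0n take0.
  by have [ei bi] := w_edge _ (mod_lt t); rewrite stS; apply: stepC.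
have v_st0 : valid (st 0) by case/badP: (badC _ (st_C 0)).
have [|rr [M0 [fit [[Ha Hb _] [Hd He Hf Hg]]]]] := @walk_branch st c v_st0.
  by move=> t; split; [case: (w_edge _ (mod_lt t))|apply: stS].
have visit q u i : inner (u, i) -> exists t, [/\ q * l <= t < q.+1 * l, st t = u & c t = i].
  move=> /inL/cov[s1 [s2 [/= e eu]]].
  have sl : size s1 < l by rewrite /l e size_cat addnS ltnS leq_addr.
  exists (q * l + size s1); rewrite leq_addr mulSn [l + _]addnC ltn_add2l sl.
  by rewrite /st /c modnMDl modn_small // {1 2}e take_size_cat // nth_cat ltnn subnn.
(* Round [M0] lies inside the tail, as M0 * l >= M0, and ends at [M1]; it crosses every edge of [C]
   once more. *)
pose M1 := M0.+1 * l.
have M0_le t : M0 * l <= t -> M0 <= t.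
  by move=> H; apply: leq_trans H; apply: leq_pmulr.
have /choice[tv Htv] : forall u, exists t, u \in C -> M1 <= t /\ st t = u.
  move=> u; have [uC|/negP uC] := boolP (u \in C); last by exists 0.
  have [i ei bi] := bad_step (badC u uC).
  have [t [/andP[le _] e _]] := @visit M0.+1 u i (And3 uC ei bi).
  by exists t.
(* Each node takes its rule from a visit after [M1], while [Z] is collected before [M1]; [early]
   moves two-premiss rules back to the earlier round. *)
pose r u := rr (tv u).
have fit_r u : u \in C -> fits (r u) u.
  by move=> uC; have := fit (tv u); rewrite (Htv u uC).2.
have live_inner u i : live C Gam r step u i -> inner (u, i).
  move=> [uC siC e]; split=> //=; last exact: badC.
  by have [_ _ H] := fit_r u uC; rewrite /edge -H e.
have early u i : live C Gam r step u i -> size (prems (r u)) = 2 ->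
    exists t, [/\ M0 <= t, t < M1, rr t = r u, c t = i & st t = u].
  move=> lu s2; have [uC _ _] := lu.
  have [t [/andP[le lt] e ci]] := @visit M0 u i (live_inner _ _ lu).
  exists t; split=> //; first exact: M0_le.
  by apply/esym/(fits_det (fit_r u uC)) => //; rewrite -e.
pose case_var t := if rr t is CaseR _ z then (if c t == 1 then Some z else None) else None.
pose Z := undup (pmap case_var (iota M0 (M1 - M0))).
have ZP z : z \in Z -> exists t G, [/\ M0 <= t, t < M1, rr t = CaseR G z & c t = 1].
  rewrite mem_undup mem_pmap => /mapP[t]; rewrite mem_iota => /andP[le lt] e.
  have lt' : t < M1.
    have lM : M0 <= M1 by rewrite /M1; apply: leq_trans (leqnSn _) _; apply: leq_pmulr.
    by move: lt; rewrite subnKC.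
  move: e; rewrite /case_var; case E : (rr t) => // [G y]; case: eqP => // c1 [->].
  by exists t, G.
have inZ t G z : M0 <= t -> t < M1 -> rr t = CaseR G z -> c t = 1 -> z \in Z.
  move=> le lt e c1; rewrite mem_undup mem_pmap; apply/mapP; exists t.
    by rewrite mem_iota le subnKC // (leq_trans le (ltnW lt)).
  by rewrite /case_var e c1.
have [_ nd] := badP _ bv0; apply: nd.
apply: (@component_derivable n N C Gam r step Z) => //.
- exact: undup_uniq.
- by move=> u uC; have [sc e _] := fit_r u uC.
- move=> u i G uC e; have [_ _ H] := fit_r u uC.
  have ei : edge u i by rewrite /edge -H e.
  move: (e); rewrite H edge_Gam // => /Some_inj eG.
  have [d|nd] := pselect (derivable T G); [by left|right].
  have bi : bad (step u i) by apply/badP; split; [exact: edge_valid|rewrite eG].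
  by split=> //; [apply: stepC|rewrite e eG].
- move=> u G y e lu; have [|t [le _ et ct _]] := early u 0 lu; first by rewrite e.
  by apply: (Ha t G y le) => //; rewrite et.
- move=> u G z lu e; have [|t [le lt et ct _]] := early u 1 lu; first by rewrite e.
  by apply: (inZ t G z le lt) => //; rewrite et.
- move=> u G y f z uC e; apply/negP => /ZP[t [G' [le lt et ct]]].
  have [leM _] := Htv u uC.
  (* The (case) happens before [M1] and the (∀) not before it, so condition (b) applies. *)
  exact: (Hb t G' z (tv u) G y f le et ct (leq_trans lt leM)).
- move=> u i G f g lu e; have [|t [le _ et ct _]] := early u i lu; first by rewrite e.
  by rewrite -ct; apply: (Hd t G f g le); rewrite et.
- move=> u i G y f z [uC _ _] e; have [leM _] := Htv u uC.
  apply: (He (tv u) G y f z) => //; apply: leq_trans leM; rewrite /M1.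
  by apply: leq_trans (leqnSn _) _; apply: leq_pmulr.
- move=> u i G f lu e; have [|t [le _ et ct _]] := early u i lu; first by rewrite e.
  by rewrite -ct; apply: (Hf t G f le); rewrite et.
- move=> u G z f lu e fG zf; have [|t [le _ et ct _]] := early u 1 lu; first by rewrite e.
  by apply: (Hg t G z le) fG zf => //; rewrite et.
- move=> z /ZP[t [G [le lt et ct]]]; exists (st t) => // f fG zf.
  have [_ eG _] := fit t; rewrite et /= in eG; rewrite -eG in fG.
  exact: (Hg t G z le et ct).
- move=> st' c' H.
  have v0' : valid (st' 0) by have [[uC _ _] _] := H 0; case/badP: (badC _ uC).
  (* This walk has a branch with rules of its own. Its (case), having two premisses, must coincide
     with the rule chosen by [r]. *)
  have [|rr' [M' [fit' [[_ _ [t [G [y e]]]] _]]]] := @walk_branch st' c' v0'.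
    by move=> t; have [/live_inner[/= _ ei _] ->] := H t.
  have [[uC _ _] _] := H t; exists t, G, y.
  by rewrite -e; apply/esym/(fits_det (fit' t) (fit_r _ uC)); rewrite e.
- move=> Q u uC Qu back' u' u'C; have /connectP[p Hp e] := conn u' u u'C uC.
  elim: p u' u'C Hp e => [|a p IH] u' u'C /=; first by move=> _ <-.
  move=> /andP[ua Hp] e; have [i ei es] := succP ua.
  have ba : bad (step u' i) by rewrite es; case/and3P: ua.
  have aC : a \in C by rewrite -es; apply: stepC.
  have Qa := IH a aC Hp e; apply: (back' u' i); last by rewrite es.
  have [_ _ H] := fit_r u' u'C.
  by split=> //; [rewrite es|rewrite H edge_Gam].
Qed.

End Graph.

Theorem theorem1 (n : nat) (G : sequent) :
  S_provable n G -> proves (ISigma n.+1) (bigvee G).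
Proof.
move=> [P [[rules _] [ps reg] restricted root]].
have [step stepP] := step_ex reg.
have dG : derivable (ISigma n.+1) G.
  (* The root address need not be listed in [ps], but its representative carries the same
     sequent. *)
  apply: contrapT => nd; have [|q qps iso] := reg [::]; first by rewrite root.
  have mq : mark P q = Some G by rewrite -root -[q]cats0 -iso.
  have /negP := no_bad rules restricted stepP (SeqSub qps); apply; apply/badP.
  by rewrite /valid /Gam /= mq.
have /prov_enum/prov_bigor/provE := dG; rewrite mset_cons /proves.
suff -> : seq_mset [::] = mset0 :> sequent by rewrite msetD0.
by apply/msetP => x; rewrite mset_seqE mset0E.
Qed.
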